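(* Let $p\ge q\ge 2$, $G_c=SU(p+q)$, $K=S(U(p)\times U(q))$. For a highest spherical weight $\lambda=\sum_{j=1}^q 2m_je_j$ put $n_j=m_j+q-j$, $j=1,\dots,q$, and let $\phi_\lambda$ be the corresponding spherical function. (i) If $X\in\mathfrak a$ and $\exp iX\in A\setminus N_{G_c}(K)$, then there is a constant $C$, depending on $p,q$ and $X$ but not on $\lambda$, such that for every highest spherical weight $\lambda$, $$|\phi_\lambda(\exp iX)|\le C\prod_{j=1}^{q-1}(n_j+1)^{-1}\ \text{ if } p>q,\qquad |\phi_\lambda(\exp iX)|\le C\prod_{j=1}^{q-1}(n_j+1)^{-1/2}\ \text{ if } p=q.$$ (ii) If $\exp iX$ is regular, then there is a constant $C=C(p,q,X)$ such that for every highest spherical weight $\lambda$, $$|\phi_\lambda(\exp iX)|\le C\prod_{j=1}^{q}(n_j+1)^{-p+j-1/2}.$$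
   Context: Let $p\ge q\ge2$, $G_c=SU(p+q)$ and $K=S(U(p)\times U(q))$ (block-diagonal matrices). $N_{G_c}(K)$ is the normalizer of $K$ in $G_c$. For $t_1,\dots,t_q\in\mathbb R$ let $X(t_1,\dots,t_q)$ be the $(p+q)\times(p+q)$ matrix $\begin{bmatrix} 0 & 0 & M \\ 0 & 0 & 0 \\ M' & 0 & 0 \end{bmatrix}$ (block sizes $q,\,p-q,\,q$), where $M,M'$ are $q\times q$ anti-diagonal with anti-diagonal entries $t_1,\dots,t_q$ and $t_q,\dots,t_1$ respectively. Let $\mathfrak a$ be the space of all such matrices and $A=\exp i\mathfrak a\subseteq G_c$. The element $X=X(t_1,\dots,t_q)$, or $\exp iX$, is regular if $t_j\not\equiv\pm t_k \bmod \pi$ for all $j\ne k$ and $t_k\not\equiv 0,\pi/2\bmod\pi$ for all $k$ (equivalently $\alpha(X)\not\equiv0\bmod\pi$ for every restricted root $\alpha$). The highest spherical weights are $\Lambda_{sph}=\{\sum_{j=1}^q 2m_je_j: m_j\in\mathbb N,\ m_1\ge m_2\ge\cdots\ge m_q\ge0\}$, where $e_j$ are the standard basis vectors of $\mathbb R^q$ and $0\in\mathbb N$. With $n_j=m_j+q-j$ one has $n_1>\cdots>n_q\ge0$. The spherical function $\phi_\lambda$ of $G_c/K$ corresponding to $\lambda$ is the $K$-bi-invariant function $g\mapsto\langle\pi_\lambda(g)v,v\rangle$, with $\pi_\lambda$ the irreducible unitary representation of $G_c$ with highest (restricted) weight $\lambda$ and $v$ a $K$-fixed unit vector. On $A$ it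 is given by the Berezin–Karpelevich formula $$\phi_\lambda(\exp iX(t_1,\dots,t_q))=\frac{C_{p,q}\det\big(\widetilde P_{n_j}(\cos2t_k)\big)_{j,k=1}^q}{\prod_{1\le j<k\le q}(\cos2t_j-\cos2t_k)\,(n_j(n_j+r)-n_k(n_k+r))},$$ where $r=p-q+1$, $C_{p,q}=2^{q(q-1)/2}\prod_{j=1}^{q-1}j!(j+p-q)^{q-j}$, $\widetilde P_n(x)=P_n^{(p-q,0)}(x)/P_n^{(p-q,0)}(1)$ with $P_n^{(a,b)}$ the Jacobi polynomials, and the quotient is understood in the limiting sense (continuous extension) when some $\cos2t_j=\cos2t_k$, $j\neq k$. *)

(* Defs.v *)
From HB Require Import structures.
From mathcomp Require Import all_boot all_order all_algebra complex.
From mathcomp Require Import all_classical all_reals all_analysis.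
Set Implicit Arguments.
Unset Strict Implicit.
Unset Printing Implicit Defensive.
Import Order.TTheory GRing.Theory Num.Theory numFieldNormedType.Exports.
Local Open Scope classical_set_scope.
Local Open Scope sesquilinear_scope.
Local Open Scope ring_scope.

(* The metric topology of the modulus on [R[i]], hence the entrywise topology
   on complex matrices. *)
HB.instance Definition _ (R : realType) :=
  PseudoMetricNormedZmod.copy R[i] (R[i])^o.

Definition expmx (R : realType) (n : nat) (A : 'M[R[i]]_n) : 'M[R[i]]_n :=
  lim (series (fun k : nat => (k`!%:R : R[i])^-1 *: A ^+ k) @ \oo).

Definition SU (R : realType) (n : nat) : set 'M[R[i]]_n :=
  [set g | g \is unitarymx /\ \det g = 1].

Definition SUxU (R : realType) (p q : nat) : set 'M[R[i]]_(p + q) :=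
  [set g | [/\ SU g, ursubmx g = 0 & dlsubmx g = 0]].

Definition normalizer (R : realType) (n : nat) (G H : set 'M[R[i]]_n) :
    set 'M[R[i]]_n :=
  [set g | G g /\ [set g *m h *m invmx g | h in H] = H].

(* With respect to the blocks of sizes p and q the matrix X(t) is
   [[0, B], [B', 0]], where B is M followed by p - q zero rows and B' is M'
   followed by p - q zero columns.  Indices start at 0, so the anti-diagonal
   is i + j = q - 1, and [rev_ord j] is q - 1 - j: the entry of M in row i is
   t_i, the entry of M' in row i is t_(q-1-i). *)
Definition Xmx (R : realType) (p q : nat) (t : 'rV[R]_q) : 'M[R[i]]_(p + q) :=
  block_mx
    0 (\matrix_(i < p, j < q)
         if (i + j == q.-1)%N then (t 0 (rev_ord j))%:C%C else 0)
    (\matrix_(i < q, j < p)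
         if (i + j == q.-1)%N then (t 0 (rev_ord i))%:C%C else 0) 0.

Definition expiX (R : realType) (p q : nat) (t : 'rV[R]_q) : 'M[R[i]]_(p + q) :=
  expmx ('i%C *: Xmx p t).

Definition eqmod_pi (R : realType) (x y : R) : Prop :=
  exists z : int, x - y = z%:~R * pi.

Definition regular (R : realType) (q : nat) (t : 'rV[R]_q) : Prop :=
  (forall j k : 'I_q, j != k ->
     ~ eqmod_pi (t 0 j) (t 0 k) /\ ~ eqmod_pi (t 0 j) (- t 0 k)) /\
  (forall k : 'I_q, ~ eqmod_pi (t 0 k) 0 /\ ~ eqmod_pi (t 0 k) (pi / 2)).

Record irreducible_unitary_rep (R : realType) (n d : nat)
    (rho : 'M[R[i]]_n -> 'M[R[i]]_d) : Prop := IrreducibleUnitaryRep {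
  rep_dim_gt0 : (0 < d)%N;
  rep_one : rho 1%:M = 1%:M;
  rep_mul : forall g h : 'M[R[i]]_n, SU g -> SU h ->
    rho (g *m h) = rho g *m rho h;
  rep_unitary : forall g : 'M[R[i]]_n, SU g -> rho g \is unitarymx;
  rep_continuous : {within @SU R n, continuous rho};
  rep_irreducible : forall U : {vspace 'cV[R[i]]_d},
    (forall g : 'M[R[i]]_n, SU g -> forall x, x \in U -> rho g *m x \in U) ->
    U = 0%VS \/ U = fullv }.

(* A linear functional on the space of the X(t) is given by its coordinates
   mu in the basis e_j, where e_j (X(t)) = t_j. *)
Definition restricted_weight (R : realType) (p q d : nat)
    (rho : 'M[R[i]]_(p + q) -> 'M[R[i]]_d) (mu : 'rV[R]_q) : Prop :=
  exists2 w : 'cV[R[i]]_d, w != 0 &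
    forall t : 'rV[R]_q,
      let theta := \sum_(j < q) mu 0 j * t 0 j in
      rho (expiX p t) *m w = (cos theta +i* sin theta)%C *: w.

(* Simple roots of the positive restricted roots e_j - e_k, e_j + e_k (j < k),
   2 e_j, and e_j when q < p: type BC_q if q < p, type C_q if p = q. *)
Definition simple_restricted_root (R : realType) (p q : nat) (j : 'I_q) :
    'rV[R]_q :=
  \row_(k < q)
    if (j.+1 == q)%N then (k == j)%:R *+ (if p == q then 2 else 1)
    else (k == j)%:R - (k == j.+1 :> nat)%:R.

Definition highest_restricted_weight (R : realType) (p q d : nat)
    (rho : 'M[R[i]]_(p + q) -> 'M[R[i]]_d) (lam : 'rV[R]_q) : Prop :=
  restricted_weight rho lam /\
  forall mu : 'rV[R]_q, restricted_weight rho mu ->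
    exists c : 'I_q -> nat,
      lam - mu = \sum_(j < q) simple_restricted_root R p j *+ c j.

(* [highest_spherical m] and [sph_weight m] describe the elements
   sum_j 2 m_j e_j of Lambda_sph. *)
Definition highest_spherical (q : nat) (m : 'I_q -> nat) : Prop :=
  forall j k : 'I_q, (j <= k)%N -> (m k <= m j)%N.

Definition sph_weight (R : realType) (q : nat) (m : 'I_q -> nat) : 'rV[R]_q :=
  \row_j (2 * m j)%:R.

(* phi is the spherical function of weight lam; only its values on SU(p + q)
   are meaningful.  The inner product <x, y> is y^* x. *)
Definition spherical_function (R : realType) (p q : nat) (lam : 'rV[R]_q)
    (phi : 'M[R[i]]_(p + q) -> R[i]) : Prop :=
  exists (d : nat) (rho : 'M[R[i]]_(p + q) -> 'M[R[i]]_d) (v : 'cV[R[i]]_d),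
    [/\ irreducible_unitary_rep rho,
        highest_restricted_weight rho lam,
        (forall k, SUxU k -> rho k *m v = v),
        (v ^t* *m v) 0 0 = 1
      & forall g, SU g -> phi g = (v ^t* *m (rho g *m v)) 0 0].

(* Jacobi polynomial P_n^(a,b)(x), a and b natural numbers:
   sum_s C(n+a, n-s) C(n+b, s) ((x-1)/2)^s ((x+1)/2)^(n-s). *)
Definition jacobi (R : realType) (a b n : nat) (x : R) : R :=
  \sum_(s < n.+1) 'C(n + a, n - s)%:R * 'C(n + b, s)%:R *
    ((x - 1) / 2) ^+ s * ((x + 1) / 2) ^+ (n - s).

Definition jacobi_normalized (R : realType) (a b n : nat) (x : R) : R :=
  jacobi a b n x / jacobi a b n 1.

(* n_j = m_j + q - j, with j counted from 0 here. *)
Definition shifted (q : nat) (m : 'I_q -> nat) (j : 'I_q) : nat :=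
  (m j + (q - j.+1))%N.

Definition BK_const (p q : nat) : nat :=
  (2 ^ 'C(q, 2) * \prod_(1 <= j < q) (j`! * (j + (p - q)) ^ (q - j)))%N.

Definition BK_quotient (R : realType) (p q : nat) (m : 'I_q -> nat)
    (t : 'rV[R]_q) : R :=
  let x (k : 'I_q) := cos (2 * t 0 k) in
  let N (j : 'I_q) : R :=
    (shifted m j * (shifted m j + (p - q).+1))%:R in
  (BK_const p q)%:R *
  \det (\matrix_(j < q, k < q) jacobi_normalized (p - q) 0 (shifted m j) (x k)) /
  \prod_(j < q) \prod_(k < q | (j < k)%N) ((x j - x k) * (N j - N k)).

Definition distinct_cos (R : realType) (q : nat) : set 'rV[R]_q :=
  [set t | forall j k : 'I_q, j != k -> cos (2 * t 0 j) != cos (2 * t 0 k)].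

(* Berezin-Karpelevich formula for phi: equality with the quotient where its
   denominator does not vanish, continuous extension of it elsewhere. *)
Definition Berezin_Karpelevich (R : realType) (p q : nat) (m : 'I_q -> nat)
    (phi : 'M[R[i]]_(p + q) -> R[i]) : Prop :=
  (forall t : 'rV[R]_q, distinct_cos t ->
     phi (expiX p t) = (BK_quotient p m t)%:C%C) /\
  (forall t : 'rV[R]_q,
     (BK_quotient p m s)%:C%C @[s --> within (@distinct_cos R q) (nbhs t)]
       --> phi (expiX p t)).

(* Main.v *)
Require Import Defs.
From HB Require Import structures.
From mathcomp Require Import all_boot all_order all_algebra complex.
From mathcomp Require Import all_classical all_reals all_analysis.
From mathcomp Require Import perm ring lra zify.
Import Order.TTheory GRing.Theory Num.Theory numFieldNormedType.Exports.
Local Open Scope sesquilinear_scope.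
Local Open Scope ring_scope.
Set Implicit Arguments.
Unset Strict Implicit.
Unset Printing Implicit Defensive.

(** Write [a = p - q], [y_k = cos (2 t_k)], let [f_n] be the Jacobi polynomial
    of parameters [(a, 0)] and degree [n] normalized by [f_n(1) = 1], and let
    [N_j = n_j (n_j + a + 1)] be its eigenvalue for [n = n_j].

    Since the [f_n] are polynomials, the quotient of [det (f_(n_j)(y_k))] by
    the Vandermonde product of the [y_k] is the determinant of the divided
    differences of the [f_(n_j)], a polynomial in the nodes.  As the nodes are
    distinct on a dense set of [t], the Berezin-Karpelevich formula holds at
    every [t] with this determinant ([Berezin_Karpelevich_ext]), and this
    determinant is, up to a nonzero factor that depends on [t] only, the
    confluent determinant [D] whose column [k] holds the Taylor coefficients
    of order [e] of the [f_(n_j)] at [y_k], where [e] is the number of earlier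
    nodes equal to [y_k] ([det_taylor_divdiff]).  So the task is to bound [D]
    divided by the product of the [N_j - N_k], where [n_j + 1 <= N_j - N_k]
    for [j < k].

    Two facts on Jacobi polynomials are used.  At an interior point [y], the
    Taylor coefficient of order [e] is at most a constant times [(n + 1) ^ (e
    - 1/2)] before normalization ([taylor_jacp_bound]), hence [(n + 1) ^ (e -
    a - 1/2)] for [f_n]: the derivative of a Jacobi polynomial is a Jacobi
    polynomial with raised parameters, raised parameters reduce to Legendre
    polynomials by contiguity, and for Legendre polynomials a quadratic form
    in two consecutive ones decreases with the degree ([legendre_energy_le]).
    At [1] and [-1], the Taylor coefficient of order [e] is the boundary value
    times a polynomial of degree [e] in the eigenvalue
    ([taylor_jacp_endpoint]); there the cancellations in the determinant
    matter, because the [N_j] may be close to each other.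

    To exploit both at once, [D] is expanded as the sum, over all assignments
    of a group of equal nodes to each row, of determinants that keep only the
    entries whose row and column lie in the same group ([det_mask]).  In the
    groups of the nodes [1] and [-1] the columns are replaced by Newton
    polynomials based at the rows of the group, and in the other groups a
    rearrangement inequality is applied.  Each assignment then contributes at
    most a constant times the product of the [N_j - N_k] over the pairs of
    rows in the same group ([det_masked_bound]).

    If two of the [y_k] differ, only assignments that separate some rows
    contribute, and the missing factors [N_j - N_k] give the product of
    the [(n_j + 1)^-1] over all [j] but the last ([det_grouped_gain]).  If all
    [y_k] equal some [y], then the values [y = 1], and [y = -1] with [p = q],
    are excluded because [exp iX] would normalize [K], as the explicit form of
    the exponential shows; otherwise the decay comes from the size of [f_n]
    near [y], namely [(n + 1) ^ (- a - 1/2)] in the interior, and the absolute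
    value [1 / 'C(n + a, a)] at [-1].  At a regular point the Leibniz formula,
    the interior bound and the inequality on [N_j - N_k] suffice. *)

(** * Jacobi polynomials with natural parameters *)

(** The homogeneous form of degree [n] in [u] and [v] with coefficients [c]. *)
Definition hform (A : comNzRingType) (c : nat -> A) (n : nat) (u v : A) : A :=
  \sum_(s < n.+1) c s * (u ^+ s * v ^+ (n - s)).

Lemma eq_hform (A : comNzRingType) (c d : nat -> A) n u v :
  (forall s, (s <= n)%N -> c s = d s) -> hform c n u v = hform d n u v.
Proof. by move=> e; apply: eq_bigr => s _; rewrite e // -ltnS. Qed.

Lemma hformD (A : comNzRingType) (c d : nat -> A) n u v :
  hform c n u v + hform d n u v = hform (fun s => c s + d s) n u v.
Proof. by rewrite -big_split; apply: eq_bigr => s _; rewrite mulrDl. Qed.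

Lemma hformZ (A : comNzRingType) (k : A) (c : nat -> A) n u v :
  k * hform c n u v = hform (fun s => k * c s) n u v.
Proof. by rewrite mulr_sumr; apply: eq_bigr => s _; rewrite mulrA. Qed.

Lemma hform_mulu (A : comNzRingType) (c : nat -> A) n u v :
  u * hform c n u v = hform (fun s => if s is s'.+1 then c s' else 0) n.+1 u v.
Proof.
rewrite [RHS]big_ord_recl /= mul0r add0r mulr_sumr; apply: eq_bigr => s _.
by rewrite /bump /= subSS exprS; ring.
Qed.

Lemma hform_mulv (A : comNzRingType) (c : nat -> A) n u v : c n.+1 = 0 ->
  v * hform c n u v = hform c n.+1 u v.
Proof.
move=> c0; rewrite [RHS]big_ord_recr /= c0 mul0r addr0 mulr_sumr.
apply: eq_bigr => s _; have sn : (s <= n)%N by rewrite -ltnS.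
by rewrite subSn // exprS; ring.
Qed.

Lemma deriv_hform (R : comNzRingType) (k : nat -> nat) (n : nat)
    (u v : {poly R}) (h : {poly R}) : u^`() = h -> v^`() = h ->
  (hform (fun s => (k s)%:R) n.+1 u v)^`() =
  h * hform (fun s => (s.+1 * k s.+1 + (n.+1 - s) * k s)%:R) n u v.
Proof.
move=> du dv; rewrite raddf_sum /=.
have e s : ((k s)%:R * (u ^+ s * v ^+ (n.+1 - s)))^`() =
    h * ((s * k s)%:R * (u ^+ s.-1 * v ^+ (n.+1 - s))) +
    h * (((n.+1 - s) * k s)%:R * (u ^+ s * v ^+ (n - s))).
  have -> : (n - s = (n.+1 - s).-1)%N by lia.
  rewrite mulr_natl derivMn derivM !deriv_exp du dv.
  rewrite -[LHS]mulr_natl -[_ *+ s]mulr_natl -[_ *+ (n.+1 - s)]mulr_natl.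
  by rewrite !natrM; ring.
rewrite (eq_bigr _ (fun (s : 'I_n.+2) _ => e s)) big_split /=.
rewrite big_ord_recl /= mul0n mul0r mulr0 add0r.
rewrite [X in _ + X]big_ord_recr /= subnn mul0n mul0r mulr0 addr0.
rewrite -big_split mulr_sumr; apply: eq_bigr => s _ /=.
by rewrite /bump /= add1n subSS natrD; ring.
Qed.

(** Coefficient of [((x - 1) / 2) ^+ s * ((x + 1) / 2) ^+ (n - s)] in the
    Jacobi polynomial of parameters [a], [b] and degree [n].  Writing the first
    factor as C(n + a, a + s) makes it vanish for [n < s]. *)
Definition jac_coef (a b n s : nat) : nat := 'C(n + a, a + s) * 'C(n + b, s).

(** The Jacobi polynomial of parameters [a], [b] and degree [n]. *)
Definition jacp (R : realFieldType) (a b n : nat) : {poly R} :=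
  hform (fun s => (jac_coef a b n s)%:R) n
    (2^-1 *: ('X - 1%:P)) (2^-1 *: ('X + 1%:P)).

Lemma horner_jacp (R : realFieldType) (a b n : nat) (x : R) :
  (jacp R a b n).[x] =
  hform (fun s => (jac_coef a b n s)%:R) n ((x - 1) / 2) ((x + 1) / 2).
Proof.
rewrite horner_sum; apply: eq_bigr => s _.
by rewrite -polyC_natr !(hornerE, horner_exp) ![2^-1 * _]mulrC.
Qed.

Lemma jac_coef0 a b n s : (n < s)%N -> jac_coef a b n s = 0%N.
Proof. by move=> ns; rewrite /jac_coef bin_small // addnC ltn_add2l. Qed.

Lemma deriv_jacp (R : realFieldType) (a b n : nat) :
  (jacp R a b n.+1)^`() = ((n + a + b).+2%:R / 2) *: jacp R a.+1 b.+1 n.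
Proof.
rewrite (@deriv_hform _ _ _ _ _ (2^-1)%:P); last 2 first.
- by rewrite derivZ derivB derivX derivC subr0 alg_polyC.
- by rewrite derivZ derivD derivX derivC addr0 alg_polyC.
rewrite -[RHS]mul_polyC polyCM -[RHS]mulrA mulrCA; congr (_ * _).
rewrite polyC_natr hformZ; apply: eq_hform => s sn.
rewrite -natrM; congr _%:R; rewrite /jac_coef.
have -> : (n.+1 + a = n + a.+1)%N by lia.
have -> : (n.+1 + b = n + b.+1)%N by lia.
have e1 := mul_bin_left (n + b.+1) s.
have e2 := mul_bin_left (n + a.+1) (a + s).
rewrite mulnCA e1 [X in (_ + X)%N]mulnA.
have -> : (n.+1 - s = n + a.+1 - (a + s))%N by lia.
rewrite -e2 [(n + a.+1)%N]addnS addSn -[(a + s).+1]addnS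
  mulnCA -[X in (_ + X)%N]mulnA -mulnCA.
set x := 'C(_, _); set y := 'C(_, _).
have -> : (n + b.+1 - s = n.+1 + b - s)%N by lia.
have -> : (n + a + b).+2 = (n.+1 + b - s + (a + s.+1))%N by lia.
by rewrite mulnDl; nia.
Qed.

Lemma deriv_jacp0 (R : realFieldType) (a b : nat) : (jacp R a b 0)^`() = 0.
Proof.
rewrite /jacp /hform big_ord_recl big_ord0 addr0 !expr0 !mulr1 -polyC_natr.
exact: derivC.
Qed.

Lemma jacp_at1 (R : realFieldType) (a b n : nat) :
  (jacp R a b n).[1] = 'C(n + a, a)%:R.
Proof.
rewrite horner_jacp /hform big_ord_recl big1 => [|s _].
  rewrite expr0 subn0 mul1r addr0 /jac_coef addn0 bin0 muln1.
  by rewrite (_ : (1 + 1) / 2 = 1) ?expr1n ?mulr1 //; field.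
by rewrite subrr mul0r expr0n mul0r mulr0.
Qed.

Lemma jacp_atN1 (R : realFieldType) (a b n : nat) :
  (jacp R a b n).[-1] = (-1) ^+ n * 'C(n + b, b)%:R.
Proof.
rewrite horner_jacp /hform big_ord_recr big1 /= => [|s _].
  rewrite subnn add0r mulr1 /jac_coef addnC binn mul1n.
  rewrite -(@bin_sub (n + b) n) ?leq_addr // addKn mulrC; congr (_ ^+ _ * _).
  by field.
by rewrite addNr mul0r expr0n subn_eq0 leqNgt ltn_ord /= !mulr0.
Qed.

(** Contiguity relation raising the first parameter. *)
Lemma jacp_raise (R : realFieldType) (a b n : nat) (x : R) :
  (n.*2 + a + b).+2%:R * ((1 - x) / 2) * (jacp R a.+1 b n).[x] =
  (n + a).+1%:R * (jacp R a b n).[x] - n.+1%:R * (jacp R a b n.+1).[x].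
Proof.
rewrite !horner_jacp; set u := (x - 1) / 2; set v := (x + 1) / 2.
have -> : (1 - x) / 2 = - u by rewrite /u; field.
set h := hform _ n u v; set h' := hform _ n _ _.
(* The form of degree n is multiplied by v - u = 1. *)
have -> : h' = v * h' - u * h' 
  by rewrite -mulrBl /u /v; field.
set h3 := hform _ n.+1 u v; set K := _%:R; set k1 := _%:R; set k2 := _%:R.
have -> : K * - u * h = - K * (u * h) by ring.
have -> : k1 * (v * h' - u * h') - k2 * h3 =
  k1 * (v * h') + - k1 * (u * h') + - k2 * h3 by ring.
rewrite hform_mulv ?jac_coef0 // !hform_mulu !hformZ !hformD.
apply: eq_hform => -[|s] sn.
  rewrite /jac_coef !addn0 !bin0 !muln1 mulr0.
  have := mul_bin_down (n + a).+1 a; rewrite /= subSn ?leq_addl // addnK => e.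
  by rewrite mulr0 addr0 mulNr -!natrM e addSn subrr.
rewrite /jac_coef.
have eX := mul_bin_diag (n + a).+1 (a + s).
have eY := mul_bin_down (n + a).+1 (a + s).+1.
have eB := mul_bin_left (n + b) s.
rewrite /= in eX eY; rewrite !addnS !addSn in eX eY *.
rewrite ['C((n + b).+1, _)]binS.
move: eX eY eB; set X := 'C(_.+1, _.+1); set A0 := 'C(_, (a + s)%N).
set A1 := 'C(_, (a + s).+1); set B0 := 'C(_, s); set B1 := 'C(_, s.+1).
have -> : ((n + a).+1 - (a + s).+1 = n - s)%N by lia.
move=> /(congr1 (fun i => i%:R : R)) eX /(congr1 (fun i => i%:R : R)) eY.
move=> /(congr1 (fun i => i%:R : R)) eB.
have sb : (s <= n + b)%N by lia.
rewrite !natrM natrB // in eX eY eB *; rewrite natrD.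
have -> : k1 * (A1%:R * B1%:R) = (n%:R - s%:R) * X%:R * B1%:R.
  by rewrite -eY /k1; ring.
have -> : - k1 * (A0%:R * B0%:R) = - ((a + s).+1%:R * X%:R) * B0%:R.
  by rewrite -eX /k1; ring.
have -> : (n%:R - s%:R) * X%:R * B1%:R + - ((a + s).+1%:R * X%:R) * B0%:R +
    - k2 * (X%:R * (B1%:R + B0%:R)) =
  - (s.+1%:R * B1%:R * X%:R) - ((a + s).+1%:R + k2) * X%:R * B0%:R.
  by rewrite /k2 -[n.+1]addn1 -[s.+1]addn1 -[(a + s).+1]addn1 !natrD; ring.
rewrite eB natrB // /K /k2 -addnn; ring.
Qed.

(** Reflection exchanges the parameters. *)
Lemma jacp_opp (R : realFieldType) (a b n : nat) (x : R) :
  (jacp R a b n).[- x] = (-1) ^+ n * (jacp R b a n).[x].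
Proof.
rewrite !horner_jacp /hform (reindex_inj rev_ord_inj) mulr_sumr /=.
apply: eq_bigr => s _; have sn : (s <= n)%N by rewrite -ltnS.
rewrite subSS subKn // /jac_coef.
rewrite -[X in ((X * _)%N)%:R]bin_sub; last by lia.
rewrite -['C(n + b, _)]bin_sub; last by lia.
have -> : (n + a - (a + (n - s)) = s)%N by lia.
have -> : (n + b - (n - s) = b + s)%N by lia.
have -> : (- x - 1) / 2 = - ((x + 1) / 2) by field.
have -> : (- x + 1) / 2 = - ((x - 1) / 2) by field.
have -> : (-1 : R) ^+ n = (-1) ^+ (n - s) * (-1) ^+ s by rewrite -exprD subnK.
rewrite mulnC !(exprNn (_ / 2)); ring.
Qed.

Lemma legendre_rec (R : realFieldType) (n : nat) (x : R) :
  n.+2%:R * (jacp R 0 0 n.+2).[x] =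
  (n.+1 + n.+2)%:R * x * (jacp R 0 0 n.+1).[x] - n.+1%:R * (jacp R 0 0 n).[x].
Proof.
rewrite !horner_jacp; set u := (x - 1) / 2; set v := (x + 1) / 2.
set h2 := hform _ n.+2 _ _; set h1 := hform _ n.+1 _ _; set h := hform _ n _ _.
set k2 := n.+2%:R; set k1 := n.+1%:R; set k := _%:R.
(* Both sides become forms of degree n + 2 through x = u + v, v - u = 1. *)
have -> : h = v * (v * h) - (u * (v * h)) *+ 2 + u * (u * h).
  by rewrite /u /v; field.
have -> : k * x * h1 = k * (u * h1) + k * (v * h1) by rewrite /u /v; field.
have -> : k * (u * h1) + k * (v * h1) -
    k1 * (v * (v * h) - u * (v * h) *+ 2 + u * (u * h)) =
  k * (u * h1) + k * (v * h1) + (- k1 * (v * (v * h)) +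
    (k1 *+ 2) * (u * (v * h)) + - k1 * (u * (u * h))) by ring.
rewrite !(hform_mulv, hform_mulu) ?jac_coef0 // !(hformZ, hformD).
apply: eq_hform => s sn; rewrite /jac_coef !addn0 !add0n.
case: s sn => [|s] sn; first by rewrite !bin0 /k /k1 /k2; ring.
case: s sn => [|s] sn; first by rewrite !bin0 !bin1 /k /k1 /k2; ring.
have := mul_bin_left n s; have := mul_bin_left n s.+1.
rewrite !add0n !binS; set c := 'C(n, s.+2); set b := 'C(n, s.+1).
set a := 'C(n, s).
move=> /(congr1 (fun i => i%:R : R)) ec /(congr1 (fun i => i%:R : R)) eb.
have [ns|ns] := leqP n s.
  have -> : c = 0%N by rewrite /c bin_small //; lia.
  have -> : b = 0%N by rewrite /b bin_small //; lia.
  by rewrite /k /k1 /k2; ring.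
rewrite !natrM (natrB _ (ltnW ns)) in eb; rewrite !natrM (natrB _ ns) in ec.
have s1 : s.+1%:R != 0 :> R by rewrite pnatr_eq0.
have s2 : s.+2%:R != 0 :> R by rewrite pnatr_eq0.
have ns0 : n%:R - s%:R != 0 :> R.
  by rewrite subr_eq0 eqr_nat; apply: contraTneq ns => ->; rewrite ltnn.
have ea : a%:R = s.+1%:R * b%:R / (n%:R - s%:R) :> R 
  by rewrite eb mulrC mulKf.
have ec' : c%:R = (n%:R - s.+1%:R) * b%:R / s.+2%:R :> R 
  by rewrite -ec mulrC mulKf.
rewrite !(natrM, natrD) ea ec' /k /k1 /k2.
by field; rewrite ?ns0 /= -natrD pnatr_eq0.
Qed.

(** * Decay of Jacobi polynomials inside the interval *)

Lemma jacp_0 (R : realFieldType) (a b : nat) (x : R) : (jacp R a b 0).[x] = 1.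
Proof.
rewrite horner_jacp /hform big_ord_recl big_ord0 /jac_coef !add0n addn0 binn.
by rewrite bin0 !expr0 !mulr1 addr0.
Qed.

Lemma legendre_1 (R : realFieldType) (x : R) : (jacp R 0 0 1).[x] = x.
Proof.
rewrite horner_jacp /hform !big_ord_recl big_ord0 /jac_coef /= !bin1 !bin0.
by rewrite /bump /= subnn; field.
Qed.

(** A quadratic form in two consecutive Legendre polynomials.  It decreases
    with the degree and dominates [n * (1 - x ^+ 2) * P_n(x) ^+ 2], which gives
    the decay of Legendre polynomials without any integral. *)
Definition legendre_energy (R : realFieldType) (x : R) (n : nat) : R :=
  n.+1%:R ^+ 2 / (n%:R + 2^-1) * (jacp R 0 0 n.+1).[x] ^+ 2
  - 2 * x * n.+1%:R * (jacp R 0 0 n.+1).[x] * (jacp R 0 0 n).[x]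
  + n.+1%:R ^+ 2 / (n%:R + 3 / 2) * (jacp R 0 0 n).[x] ^+ 2.

Lemma legendre_energy_le (R : realFieldType) (x : R) (n : nat) :
  legendre_energy x n <= 2 / 3.
Proof.
have n0 (m : nat) : 0 <= m%:R :> R by rewrite ler0n.
elim: n => [|n].
  rewrite /legendre_energy legendre_1 jacp_0 !mulr0n !add0r.
  by rewrite le_eqVlt; apply/orP; left; apply/eqP; field.
apply: le_trans; rewrite /legendre_energy.
have -> : (jacp R 0 0 n.+2).[x] = ((2 * n%:R + 3) * x * (jacp R 0 0 n.+1).[x]
    - (n%:R + 1) * (jacp R 0 0 n).[x]) / (n%:R + 2).
  have e := legendre_rec n x; apply: (mulfI (_ : n.+2%:R != 0)).
    by rewrite pnatr_eq0.
  rewrite e -[n.+2]addn2 -[n.+1]addn1 !natrD; field.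
  by rewrite gt_eqF // ltr_wpDl.
rewrite -!natr1 -subr_ge0; have := n0 n.
move: (jacp _ _ _ n.+1).[x] (jacp _ _ _ n).[x] => P Q; move: n%:R => k k0.
(* One step of the recurrence lowers the form by a multiple of a square. *)
rewrite [X in 0 <= X](_ : _ = 2^-1 * P ^+ 2 / ((k + 2^-1) * (k + 5 / 2))).
  apply: divr_ge0; apply: mulr_ge0; rewrite ?sqr_ge0 //; lra.
by field; rewrite !gt_eqF //; lra.
Qed.

Lemma legendre_energy_ge (R : realFieldType) (x : R) (n : nat) :
  (n%:R + 3 / 2) * (1 - x ^+ 2) * (jacp R 0 0 n.+1).[x] ^+ 2
    <= legendre_energy x n.
Proof.
rewrite /legendre_energy -[n.+1%:R]natr1 -subr_ge0; have : 0 <= n%:R :> R by [].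
move: (jacp _ _ _ n.+1).[x] (jacp _ _ _ n).[x] => P Q; move: n%:R => k k0.
rewrite [X in 0 <= X](_ : _ = 4^-1 / (k + 2^-1) * P ^+ 2 +
   (k + 3 / 2) * (x * P - (k + 1) / (k + 3 / 2) * Q) ^+ 2).
  apply: addr_ge0; apply: mulr_ge0; rewrite ?sqr_ge0 ?divr_ge0 //; lra.
by field; rewrite !gt_eqF //; lra.
Qed.

Lemma legendre_bound (R : realFieldType) (x : R) (n : nat) : `|x| < 1 ->
  (jacp R 0 0 n).[x] ^+ 2 * n.+1%:R * (1 - x ^+ 2) <= 1.
Proof.
move=> x1; have x2 : 0 <= x ^+ 2 by exact: sqr_ge0.
have x3 : 0 <= 1 - x ^+ 2.
  by rewrite subr_ge0 -real_normK ?num_real // expr_le1 // ltW.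
case: n => [|n]; first by rewrite jacp_0; lra.
have := le_trans (legendre_energy_ge x n) (legendre_energy_le x n).
set P := _.[x] => h.
have n0 : 0 <= n%:R :> R by [].
have PP : 0 <= P ^+ 2 * (1 - x ^+ 2) by rewrite mulr_ge0 ?sqr_ge0.
rewrite -[n.+2%:R]natr1 -[n.+1%:R]natr1; nra.
Qed.

(** All parameters are reached from Legendre polynomials by raising the first
    parameter and by reflection. *)
Lemma jacp_bound (R : rcfType) (a b : nat) (x : R) : `|x| < 1 ->
  exists C, 0 <= C /\
    forall n, `|(jacp R a b n).[x]| <= C / Num.sqrt n.+1%:R.
Proof.
pose S a b := forall x : R, `|x| < 1 -> exists C, 0 <= C /\
  forall n, `|(jacp R a b n).[x]| <= C / Num.sqrt n.+1%:R.
suff h : S a b by exact: h.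
have sq0 n : 0 < Num.sqrt n.+1%:R :> R by rewrite sqrtr_gt0 ltr0n.
have symS c d : S c d -> S d c.
  move=> h y y1; have [|C [C0 hC]] := h (- y); first by rewrite normrN.
  exists C; split=> // n; have := hC n.
  by rewrite jacp_opp normrM normrX normrN1 expr1n mul1r.
have upS c d : S c d -> S c.+1 d.
  move=> h y y1; have [C [C0 hC]] := h y y1.
  have y2 : 0 < 1 - y by rewrite subr_gt0 (le_lt_trans (ler_norm _)).
  exists (C * (2 / (1 - y))); split.
    by rewrite mulr_ge0 // divr_ge0 // ltW.
  move=> n; set K := (n.*2 + c + d).+2%:R : R.
  have K0 : 0 < K by rewrite ltr0n.
  rewrite -(ler_pM2l (_ : 0 < K * ((1 - y) / 2))); last first.
    by rewrite mulr_gt0 // divr_gt0.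
  rewrite -[X in X * `|_|]gtr0_norm; last by rewrite mulr_gt0 // divr_gt0.
  rewrite -normrM jacp_raise.
  have -> : K * ((1 - y) / 2) * (C * (2 / (1 - y)) / Num.sqrt n.+1%:R) =
      K * (C / Num.sqrt n.+1%:R).
    by field; rewrite !gt_eqF.
  apply: le_trans (ler_normB _ _) _; rewrite !normrM !normr_nat.
  have h1 := hC n; have h2 : `|(jacp R c d n.+1).[y]| <= C / Num.sqrt n.+1%:R.
    apply: le_trans (hC _) _; apply: ler_wpM2l => //.
    by rewrite lef_pV2 ?posrE // ler_wsqrtr // ler_nat.
  apply: le_trans (lerD (ler_wpM2l _ h1) (ler_wpM2l _ h2)) _ => //.
  rewrite -mulrDl -natrD; apply: ler_wpM2r; first by rewrite divr_ge0 // ltW.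
  by rewrite ler_nat; lia.
have S0 : S 0 0.
  move=> y y1; have y2 : 0 < 1 - y ^+ 2.
    by rewrite subr_gt0 -real_normK ?num_real // expr_lt1.
  exists (Num.sqrt (1 - y ^+ 2))^-1; split; first by rewrite invr_ge0 sqrtr_ge0.
  move=> n; have := legendre_bound n y1; set P := _.[y] => h.
  rewrite -invfM -(sqrtrM _ (ltW y2)) -[leRHS]mul1r ler_pdivlMr; last first.
    by rewrite sqrtr_gt0 mulr_gt0 // ltr0n.
  rewrite -sqrtr_sqr -sqrtrM ?sqr_ge0 // -[leRHS]sqrtr1 ler_wsqrtr //.
  by rewrite [_ * n.+1%:R]mulrC mulrA.
have S1 c : S c 0 by elim: c => // c; exact: upS.
by elim: a => [|c]; [exact/symS/S1|exact: upS].
Qed.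

(** * Taylor coefficients of Jacobi polynomials *)

(** The coefficient of [h ^+ i] in [p.[y + h]]. *)
Definition taylor (R : comNzRingType) (p : {poly R}) (y : R) (i : nat) : R :=
  (p \Po ('X + y%:P))`_i.

Lemma taylor0 (R : comNzRingType) (p : {poly R}) (y : R) : taylor p y 0 = p.[y].
Proof.
by rewrite /taylor -horner_coef0 horner_comp !hornerE.
Qed.

Lemma taylorS (R : comNzRingType) (p : {poly R}) (y : R) (i : nat) :
  taylor p y i.+1 *+ i.+1 = taylor p^`() y i.
Proof.
rewrite /taylor -coef_deriv deriv_comp derivD derivX derivC addr0 mulr1 //.
Qed.

Lemma taylorZ (R : comNzRingType) (c : R) (p : {poly R}) (y : R) (i : nat) :
  taylor (c *: p) y i = c * taylor p y i.
Proof. by rewrite /taylor comp_polyZ coefZ. Qed.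

Lemma taylor_sum (R : comNzRingType) (y : R) (i m : nat) (F : nat -> {poly R}) :
  taylor (\sum_(l < m) F l) y i = \sum_(l < m) taylor (F l) y i.
Proof. by rewrite /taylor raddf_sum coef_sum. Qed.

Lemma taylor_jacpS (R : realFieldType) (a b n i : nat) (y : R) :
  taylor (jacp R a b n.+1) y i.+1 =
  (n + a + b).+2%:R / 2 / i.+1%:R * taylor (jacp R a.+1 b.+1 n) y i.
Proof.
apply: (mulIf (_ : i.+1%:R != 0)); first by rewrite pnatr_eq0.
rewrite mulr_natr taylorS deriv_jacp taylorZ [RHS]mulrAC.
by rewrite divfK // pnatr_eq0.
Qed.

Lemma taylor_jacp0 (R : realFieldType) (a b i : nat) (y : R) :
  taylor (jacp R a b 0) y i.+1 = 0.
Proof.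
apply: (mulIf (_ : i.+1%:R != 0)); first by rewrite pnatr_eq0.
by rewrite mulr_natr taylorS deriv_jacp0 /taylor comp_poly0 coef0 mul0r.
Qed.

(** Taylor coefficients at an interior point. *)
Lemma taylor_jacp_bound (R : rcfType) (a b i : nat) (y : R) : `|y| < 1 ->
  exists C, 0 <= C /\ forall n,
    `|taylor (jacp R a b n) y i| <= C * (n.+1%:R ^+ i / Num.sqrt n.+1%:R).
Proof.
move=> y1; elim: i a b => [|i IH] a b.
  have [C [C0 hC]] := jacp_bound a b y1; exists C; split=> // n.
  by rewrite taylor0 expr0 mul1r.
have [C [C0 hC]] := IH a.+1 b.+1.
pose K := (a + b).+2%:R : R.
have K0 : 0 <= K by rewrite ler0n.
exists (K * C); split=> [|n]; first by rewrite mulr_ge0.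
case: n => [|n].
  rewrite taylor_jacp0 normr0; apply: mulr_ge0; first exact: mulr_ge0.
  by apply: divr_ge0; [exact: exprn_ge0|exact: sqrtr_ge0].
have sqE m : m.+1%:R / Num.sqrt m.+1%:R = Num.sqrt m.+1%:R :> R.
  have s0 : Num.sqrt m.+1%:R != 0 :> R by rewrite gt_eqF // sqrtr_gt0 ltr0n.
  by apply: (canLR (mulfK s0)); rewrite -expr2 sqr_sqrtr // ler0n.
rewrite taylor_jacpS normrM !normrM !normfV !normr_nat.
have le1 : (n + a + b).+2%:R / 2 / i.+1%:R <= K * n.+1%:R :> R.
  rewrite -mulrA -invfM ler_pdivrMr -?natrM ?ltr0n // ler_nat.
  by nia.
apply: le_trans (ler_pM _ _ le1 (hC n)) _ => //.
rewrite -!mulrA ler_wpM2l // mulrCA ler_wpM2l // mulrCA exprS mulrAC sqE.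
rewrite mulrC sqE ler_pM ?sqrtr_ge0 ?exprn_ge0 //.
  by rewrite ler_wsqrtr // ler_nat.
by rewrite lerXn2r ?nnegrE // ler_nat.
Qed.

(** Taylor coefficients at an endpoint [y], where the value of the polynomial
    is [e ^+ n * 'C(n + d, d)] with [d] one of the two parameters.  Up to this
    value and to a factor independent of the degree [n], they are polynomials
    of degree [i] in the eigenvalue [n * (n + a + b + 1)]. *)
Lemma taylor_jacp_endpoint (R : realFieldType) (y e : R)
    (d : nat -> nat -> nat) :
  e != 0 -> (forall a b, d a.+1 b.+1 = (d a b).+1) ->
  (forall a b n, (jacp R a b n).[y] = e ^+ n * 'C(n + d a b, d a b)%:R) ->
  forall i a b, exists kappa : R, forall n, taylor (jacp R a b n) y i =
    kappa * (e ^+ n * 'C(n + d a b, d a b)%:R) * \prod_(l < i)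
      ((n * (n + (a + b).+1))%:R - (l * (l + (a + b).+1))%:R).
Proof.
move=> e0 dS val; elim=> [|i IH] a b.
  by exists 1 => n; rewrite taylor0 val big_ord0 mul1r mulr1.
have [k hk] := IH a.+1 b.+1.
exists (k / 2 / i.+1%:R / (d a b).+1%:R / e) => -[|n].
  by rewrite taylor_jacp0 big_ord_recl !mul0n subrr mul0r mulr0.
rewrite taylor_jacpS hk dS big_ord_recl mul0n subr0.
have -> : \prod_(l < i) ((n.+1 * (n.+1 + (a + b).+1))%:R -
      (lift ord0 l * (lift ord0 l + (a + b).+1))%:R) =
    \prod_(l < i) ((n * (n + (a.+1 + b.+1).+1))%:R -
      (l * (l + (a.+1 + b.+1).+1))%:R) :> R.
  by apply: eq_bigr => l _; rewrite /= /bump /= add1n; ring.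
have := mul_bin_left (n + (d a b).+1) (d a b).
have -> : (n + (d a b).+1 - d a b = n.+1)%N by lia.
have -> : (n.+1 + d a b = n + (d a b).+1)%N by lia.
move/(congr1 (fun i => i%:R : R)); rewrite !natrM.
have d0 : (d a b).+1%:R != 0 :> R by rewrite pnatr_eq0.
have i0 : i.+1%:R != 0 :> R by rewrite pnatr_eq0.
move=> eC; have -> : 'C(n + (d a b).+1, (d a b).+1)%:R =
    n.+1%:R * 'C(n + (d a b).+1, d a b)%:R / (d a b).+1%:R :> R.
  by rewrite -eC mulrC mulKf.
by rewrite exprS -addnS -addnS; field; rewrite e0 nat1r d0 nat1r i0.
Qed.

Lemma taylor_jacp_at1 (R : realFieldType) (a b i : nat) :
  exists kappa : R, forall n, taylor (jacp R a b n) 1 i =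
    kappa * 'C(n + a, a)%:R * \prod_(l < i)
      ((n * (n + (a + b).+1))%:R - (l * (l + (a + b).+1))%:R).
Proof.
have [||k hk] :=
  @taylor_jacp_endpoint R 1 1 (fun a _ => a) (oner_neq0 R) _ _ i a b.
- by [].
- by move=> c d n; rewrite expr1n mul1r jacp_at1.
by exists k => n; rewrite hk expr1n mul1r.
Qed.

Lemma taylor_jacp_atN1 (R : realFieldType) (a b i : nat) :
  exists kappa : R, forall n, taylor (jacp R a b n) (-1) i =
    kappa * ((-1) ^+ n * 'C(n + b, b)%:R) * \prod_(l < i)
      ((n * (n + (a + b).+1))%:R - (l * (l + (a + b).+1))%:R).
Proof.
have [|||k hk] :=
  @taylor_jacp_endpoint R (-1) (-1) (fun _ b => b) _ _ _ i a b.
- by rewrite oppr_eq0 oner_neq0.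
- by [].
- by move=> c d n; rewrite jacp_atN1.
by exists k.
Qed.

(** * Divided differences and confluent determinants *)

(** The Newton basis of the nodes [x 0, x 1, ...]. *)
Definition newton (R : comNzRingType) (x : nat -> R) (l : nat) : {poly R} :=
  \prod_(k < l) ((x k)%:P - 'X).

(** The coefficient of ['X^m] on the [l]-th element of the Newton basis. *)
Fixpoint dd_mon (R : comNzRingType) (x : nat -> R) (m l : nat) : R :=
  if m is m'.+1 then
    x l * dd_mon x m' l - (if l is l'.+1 then dd_mon x m' l' else 0)
  else (l == 0%N)%:R.

(** The divided difference of [f] at [x 0, ..., x l], up to sign.  It depends
    polynomially on the nodes, which may coincide. *)
Definition divdiff (R : comNzRingType) (x : nat -> R) (f : {poly R}) (l : nat) :
    R :=
  \sum_(i < size f) f`_i * dd_mon x i l.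

Lemma dd_mon0 (R : comNzRingType) (x : nat -> R) m l :
  (m < l)%N -> dd_mon x m l = 0.
Proof.
elim: m l => [|m IH] [|l] //= ml.
by rewrite !IH ?mulr0 ?subr0 // ltnW.
Qed.

Lemma Xn_newton (R : comNzRingType) (x : nat -> R) m M : (m < M)%N ->
  'X^m = \sum_(l < M) dd_mon x m l *: newton x l.
Proof.
have mulXnewton l : 'X * newton x l = x l *: newton x l - newton x l.+1.
  by rewrite /newton big_ord_recr /= -mul_polyC; ring.
elim: m M => [|m IH] [|M] // mM.
  rewrite big_ord_recl big1 ?addr0 => [|l _]; last by rewrite scale0r.
  by rewrite scale1r /newton big_ord0.
rewrite exprS (IH M) // mulr_sumr.
under eq_bigr do rewrite -scalerAr mulXnewton scalerBr.
rewrite sumrB.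
under [RHS]eq_bigr => l _ do rewrite /= scalerBl.
rewrite sumrB big_ord_recr /= dd_mon0 // mulr0 scale0r addr0.
rewrite [X in _ = _ - X]big_ord_recl scale0r add0r; congr (_ - _).
by apply: eq_bigr => l _; rewrite scalerA mulrC.
Qed.

Lemma divdiff_newton (R : comNzRingType) (x : nat -> R) (f : {poly R}) M :
  (size f <= M)%N -> f = \sum_(l < M) divdiff x f l *: newton x l.
Proof.
move=> fM; rewrite -[LHS]coefK poly_def.
under eq_bigr => i _ do
  rewrite (Xn_newton x (leq_trans (ltn_ord i) fM)) scaler_sumr.
rewrite exchange_big; apply: eq_bigr => l _ /=; rewrite scaler_suml.
by apply: eq_bigr => i _; rewrite scalerA.
Qed.

(** How many earlier nodes equal the [k]-th one. *)
Definition node_order (R : eqType) (x : nat -> R) (k : nat) : nat :=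
  (\sum_(i < k) (x i == x k))%N.

(** The Taylor coefficient of order [node_order x k] at the [k]-th node of the
    [k]-th Newton polynomial. *)
Definition node_pivot (R : fieldType) (x : nat -> R) (k : nat) : R :=
  (-1) ^+ node_order x k * \prod_(i < k | x i != x k) (x i - x k).

Lemma node_pivot_neq0 (R : fieldType) (x : nat -> R) k : node_pivot x k != 0.
Proof.
rewrite mulf_neq0 ?signr_eq0 //; apply/prodf_neq0 => i.
by rewrite subr_eq0.
Qed.

Lemma taylor_newton (R : fieldType) (x : nat -> R) l y i :
  taylor (newton x l) y i =
  if (i < \sum_(k < l) (x k == y))%N then 0 else
  (-1) ^+ (\sum_(k < l) (x k == y)) *
  (\prod_(k < l | x k != y)
     ((x k - y)%:P - 'X))`_(i - \sum_(k < l) (x k == y))%N.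
Proof.
rewrite /taylor /newton rmorph_prod /=.
under eq_bigr => k _.
  rewrite rmorphB /= comp_polyC comp_polyX opprD addrCA addrC -polyCB.
  over.
rewrite (bigID (fun k : 'I_l => x k == y)) /=.
rewrite (eq_bigr (fun _ => - 'X)) => [|k /eqP ->]; last by rewrite subrr sub0r.
rewrite prodr_const (exprNn (polyX R)) -mulrA.
have -> : #|[pred k : 'I_l | x k == y]| = (\sum_(k < l) (x k == y))%N.
  rewrite -sum1_card big_mkcond; apply: eq_bigr => k _; rewrite inE.
  by case: eqP.
set c := (\sum_(_ < _) _)%N.
have -> : (-1) ^+ c = ((-1) ^+ c)%:P :> {poly R} by rewrite rmorph_sign.
rewrite coefCM coefXnM; case: ifP => _ //.
by rewrite mulr0.
Qed.

(** The confluent determinant: the functional of the [k]-th node vanishes on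
    the Newton polynomials of larger index, so that the change of basis is
    triangular. *)
Lemma det_taylor_divdiff (R : fieldType) (q : nat) (x : nat -> R)
    (f : 'I_q -> {poly R}) :
  \det (\matrix_(j < q, k < q) taylor (f j) (x k) (node_order x k)) =
  \det (\matrix_(j < q, l < q) divdiff x (f j) l) *
  \prod_(k < q) node_pivot x k.
Proof.
pose T := \matrix_(l < q, k < q) taylor (newton x l) (x k) (node_order x k).
have vanish (k l : nat) : (k < l)%N ->
    taylor (newton x l) (x k) (node_order x k) = 0.
  move=> kl; rewrite taylor_newton ifT //.
  have -> : (\sum_(i < l) (x i == x k) = \sum_(0 <= i < l) (x i == x k))%N.
    by rewrite big_mkord.
  rewrite (big_cat_nat (leq0n k) (ltnW kl)) //= big_mkord -addn1 leq_add //.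
  by rewrite big_ltn // eqxx.
have -> : \matrix_(j < q, k < q) taylor (f j) (x k) (node_order x k) =
    (\matrix_(j < q, l < q) divdiff x (f j) l) *m T.
  apply/matrixP => j k; rewrite !mxE.
  rewrite {1}(@divdiff_newton _ x (f j) (q + size (f j))) ?leq_addl //.
  rewrite (@taylor_sum _ _ _ _ (fun l => divdiff x (f j) l *: newton x l)).
  rewrite big_split_ord /= [X in _ + X]big1 ?addr0 => [|l _].
    by apply: eq_bigr => l _; rewrite !mxE taylorZ.
  by rewrite taylorZ vanish ?mulr0 // ltn_addr.
rewrite det_mulmx; congr (_ * _); rewrite -det_tr det_trig.
  apply: eq_bigr => k _; rewrite !mxE taylor_newton -/(node_order x k) ltnn.
  rewrite subnn /node_pivot; congr (_ * _).
  rewrite -horner_coef0 horner_prod; apply: eq_bigr => i _.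
  by rewrite !hornerE ?subr0.
by apply/is_trig_mxP => k l kl; rewrite !mxE vanish.
Qed.

(** * Combinatorics of groups of indices *)

Lemma node_order_lt (T : eqType) (x : nat -> T) (k k' : nat) :
  (k < k')%N -> x k = x k' -> (node_order x k < node_order x k')%N.
Proof.
move=> kk' e; rewrite /node_order e.
have -> : (\sum_(i < k') (x i == x k') = \sum_(0 <= i < k') (x i == x k'))%N.
  by rewrite big_mkord.
rewrite (big_cat_nat (leq0n k) (ltnW kk')) /= big_mkord -addn1 leq_add //.
by rewrite big_ltn // e eqxx.
Qed.

Lemma node_order_inj (T : eqType) (x : nat -> T) (k k' : nat) :
  x k = x k' -> node_order x k = node_order x k' -> k = k'.
Proof.
move=> e o; have [kk'|kk'|//] := ltngtP k k'.
- by have := node_order_lt kk' e; rewrite o ltnn.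
- by have := node_order_lt kk' (esym e); rewrite o ltnn.
Qed.

(** Inside a class, the orders run through an initial segment. *)
Lemma big_node_order (T : eqType) (x : nat -> T) (R : Type) (idx : R)
    (op : Monoid.law idx) (F : nat -> R) (v : T) (n : nat) :
  \big[op/idx]_(k < n | x k == v) F (node_order x k) =
  \big[op/idx]_(i < \sum_(k < n) (x k == v)) F i.
Proof.
elim: n => [|n IH]; first by rewrite !big_ord0.
rewrite big_mkcond big_ord_recr /= -big_mkcond /= IH.
rewrite [in RHS]big_ord_recr /=; case: eqVneq => [xn|_].
  by rewrite addn1 big_ord_recr /= /node_order xn.
by rewrite addn0 Monoid.mulm1.
Qed.

Lemma prodr_ege1 (R : numDomainType) (I : Type) (s : seq I) (P : pred I)
    (F : I -> R) :
  (forall i, P i -> 1 <= F i) -> 1 <= \prod_(i <- s | P i) F i.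
Proof.
by move=> F1; apply: (big_ind (fun x => 1 <= x)) => // x y; exact: mulr_ege1.
Qed.

Lemma prod_le_card (R : realDomainType) (T : finType) (A B : {set T})
    (f : T -> R) :
  (forall i, 1 <= f i) -> (#|A| <= #|B|)%N ->
  (forall a b, a \in A :\: B -> b \in B :\: A -> f a <= f b) ->
  \prod_(i in A) f i <= \prod_(i in B) f i.
Proof.
move=> f1 AB fAB.
have f0 i : 0 <= f i by apply: le_trans (f1 i).
rewrite (big_setID B) [leRHS](big_setID A) /= finset.setIC.
apply: ler_wpM2l; first by apply: prodr_ge0.
have cAB : (#|A :\: B| <= #|B :\: A|)%N.
  by rewrite -(leq_add2l #|A :&: B|) {2}finset.setIC !cardsID.
have [E|[a0 a0A]] := set_0Vmem (A :\: B).
  by rewrite E big_set0; apply: prodr_ege1.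
case: (@Order.TotalTheory.arg_maxP _ R T a0 (mem (A :\: B)) f a0A) => a aA amax.
apply: (@le_trans _ _ (f a ^+ #|A :\: B|)).
  by rewrite -prodr_const; apply: ler_prod => i iA; rewrite f0; exact: amax.
apply: (@le_trans _ _ (f a ^+ #|B :\: A|)).
  by apply: ler_weXn2l.
rewrite -prodr_const; apply: ler_prod => i iB; rewrite f0 /=.
exact: fAB.
Qed.

(** Rearrangement: a product of powers of numbers at least 1 is largest when
    the exponents are ordered like the numbers. *)
Lemma prod_exp_rearrange (R : realDomainType) (T : finType) (S : {set T})
    (b : T -> R) (e r : T -> nat) :
  (forall i, 1 <= b i) ->
  (forall j k, j \in S -> k \in S -> (r j < r k)%N -> b j <= b k) ->
  (forall l,
    (#|[set j in S | (l < e j)%N]| <= #|[set j in S | (l < r j)%N]|)%N) ->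
  \prod_(j in S) b j ^+ e j <= \prod_(j in S) b j ^+ r j.
Proof.
move=> b1 br er.
have [M [eM rM]] : exists M, (forall j, e j <= M)%N /\ (forall j, r j <= M)%N.
  exists (\max_j e j + \max_j r j)%N; split=> j.
    by rewrite (leq_trans (leq_bigmax j)) ?leq_addr.
  by rewrite (leq_trans (leq_bigmax j)) ?leq_addl.
(* Each power is cut into its level sets. *)
have cut (h : T -> nat) : (forall j, h j <= M)%N ->
    \prod_(j in S) b j ^+ h j =
    \prod_(l < M) \prod_(j in [set j in S | (l < h j)%N]) b j.
  move=> hM; rewrite (exchange_big_dep (mem S)) /= => [|l j _]; last first.
    by rewrite inE => /andP[].
  apply: eq_bigr => j jS; under eq_bigl => l do rewrite inE jS /=.
  by rewrite -(big_ord_widen M (fun=> b j) (hM j)) prodr_const card_ord.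
rewrite (cut e eM) (cut r rM); apply: ler_prod => l _; apply/andP; split.
  by apply: prodr_ge0 => j _; apply: le_trans (b1 j).
apply: prod_le_card => // j k; rewrite !inE => /andP[+ /andP[jS _]].
rewrite jS /= -leqNgt => rj /andP[_ /andP[kS rk]].
by apply: br => //; apply: leq_ltn_trans rk.
Qed.

(** If [c] is not constant, the pairs of indices which it separates, each
    weighted by its larger index, dominate all indices but the first. *)
Lemma prod_separated_ge (R : realDomainType) (T : eqType) (c : nat -> T)
    (b : nat -> R) (n : nat) :
  (forall k, 1 <= b k) -> (forall j k, (j < k <= n)%N -> b j <= b k) ->
  (exists2 k, (k <= n)%N & c k != c 0%N) ->
  \prod_(k < n) b k.+1 <= \prod_(j < n.+1) \prod_(k < j | c k != c j) b j.
Proof.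
move=> b1; have b0 k : 0 <= b k by apply: le_trans (b1 k).
elim: n => [|n IH] bM [k kn ck].
  by move: kn ck; case: k => // _; rewrite eqxx.
rewrite [leRHS]big_ord_recr /=.
have [/existsP[i ci]|/existsPn cE] :=
    boolP [exists i : 'I_n.+1, c i != c 0%N].
  have [k' k'n ck'] : exists2 k', (k' <= n)%N & c k' != c n.+1.
    have [c0|c0] := eqVneq (c 0%N) (c n.+1); last by exists 0%N.
    by exists i; rewrite -?c0 // -ltnS.
  rewrite big_ord_recr /=; apply: ler_pM => //; first exact: prodr_ge0.
  apply: IH; last by exists i => //; rewrite -ltnS.
    by move=> j l /andP[jl ln]; apply: bM; rewrite jl leqW.
  rewrite -ltnS in k'n; rewrite (bigD1 (Ordinal k'n)) //= -[leLHS]mulr1.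
  by apply: ler_wpM2l => //; apply: prodr_ege1.
(* Here [c] is constant on [0..n], and [n.+1] is separated from all of it. *)
have cn : c n.+1 != c 0%N.
  move: kn; rewrite leq_eqVlt => /orP[/eqP <-//|kn].
  by have := cE (Ordinal kn); rewrite ck.
apply: le_trans (_ : 1 * \prod_(i < n.+1) b n.+1 <= _).
  rewrite mul1r; apply: ler_prod => i _; rewrite b0 /=.
  have [->//|ni] := eqVneq i.+1 n.+1; apply: bM.
  by rewrite leqnn andbT ltn_neqAle ni ltn_ord.
apply: ler_pM => //; [exact: prodr_ge0| |].
  by apply: prodr_ege1 => j _; exact: prodr_ege1.
rewrite [leRHS]big_mkcond /=; apply: ler_prod => i _; rewrite b0 /=.
by rewrite ifT //; have /negPn/eqP -> := cE i; rewrite eq_sym.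
Qed.

(** * Determinants with grouped columns *)

(** A determinant is the sum, over all assignments [c] of a group to each row,
    of the determinants of the matrices that keep an entry only if its row is
    assigned the group of its column. *)
Lemma det_mask (R : comNzRingType) (n : nat) (G : finType) (g : 'I_n -> G)
    (D : 'I_n -> 'I_n -> R) :
  \det (\matrix_(j, k) D j k) =
  \sum_(c : {ffun 'I_n -> G})
     \det (\matrix_(j, k) ((c j == g k)%:R * D j k)).
Proof.
rewrite exchange_big /=; apply: eq_bigr => s _; rewrite -mulr_sumr.
congr (_ * _); under [RHS]eq_bigr => c _ do
  under eq_bigr => j _ do rewrite mxE.
rewrite -(bigA_distr_bigA (fun (j : 'I_n) (a : G) =>
  (a == g (s j))%:R * D j (s j))).
apply: eq_bigr => j _; rewrite mxE (bigD1 (g (s j))) //= eqxx mul1r.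
rewrite big1 ?addr0 // => a /negPf ->; by rewrite mul0r.
Qed.

Lemma det_le_prod (R : realDomainType) (n : nat) (A : 'M[R]_n) (B : R) :
  (forall s : 'S_n, \prod_j `|A j (s j)| <= B) -> `|\det A| <= n`!%:R * B.
Proof.
move=> h; apply: le_trans (ler_norm_sum _ _ _) _.
apply: le_trans (ler_sum _ (_ : forall s : 'S_n, true -> _ <= B)) _ => [s _|].
  by rewrite normrM normrX normrN1 expr1n mul1r normr_prod.
by rewrite sumr_const cardT -cardE card_Sn mulr_natl.
Qed.

(** Replacing the polynomials of the columns of a group by other polynomials of
    the same degrees only multiplies the determinant by the ratio of the leading
    coefficients. *)
Lemma det_column_poly (R : fieldType) (q : nat) (x : nat -> R) (A : pred R)
    (h : 'I_q -> 'I_q -> bool) (w : 'I_q -> R -> R) (N : 'I_q -> R)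
    (D : 'I_q -> 'I_q -> R) (P : 'I_q -> {poly R}) :
  (forall j k k' : 'I_q, x k = x k' -> h j k = h j k') ->
  (forall k : 'I_q, (size (P k) <= (node_order x k).+1)%N) ->
  \det (\matrix_(j, k) ((h j k)%:R *
    (if A (x k) then w j (x k) * (P k).[N j] else D j k))) =
  \det (\matrix_(j, k) ((h j k)%:R *
    (if A (x k) then w j (x k) * N j ^+ node_order x k else D j k))) *
  \prod_(k < q) (if A (x k) then (P k)`_(node_order x k) else 1).
Proof.
move=> hx sP.
pose U : 'M[R]_q := \matrix_(l, k) if A (x k) then
  (x l == x k)%:R * (P k)`_(node_order x l) else (l == k)%:R.
have -> : \prod_(k < q) (if A (x k) then (P k)`_(node_order x k) else 1) =
    \det U.
  rewrite -det_tr det_trig; last first.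
    apply/is_trig_mxP => k l kl; rewrite !mxE; case: ifP => Ak.
      case: eqP => [e|]; rewrite ?mul0r // nth_default ?mulr0 //.
      by apply: leq_trans (sP k) _; apply: node_order_lt.
    by rewrite gt_eqF.
  by apply: eq_bigr => k _; rewrite !mxE !eqxx; case: ifP; rewrite ?mul1r.
rewrite -det_mulmx; congr (\det _); apply/matrixP => j k; rewrite !mxE.
under [RHS]eq_bigr => l _ do rewrite !mxE.
case: ifP => Ak; last first.
  rewrite (bigD1 k) //= Ak eqxx mulr1 big1 ?addr0 // => l /negPf ->.
  by rewrite mulr0.
rewrite (bigID (fun l : 'I_q => x l == x k)) /=.
rewrite [X in _ + X]big1 ?addr0; last first.
  by move=> l /negPf ->; rewrite mul0r mulr0.
pose F i := (h j k)%:R * w j (x k) * ((P k)`_i * N j ^+ i).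
rewrite (eq_bigr (fun l : 'I_q => F (node_order x l)))
  => [|l /eqP e]; last first.
  by rewrite (hx _ _ _ e) e eqxx Ak /F mul1r; ring.
rewrite (@big_node_order _ x R 0 +%R F) -mulr_sumr mulrA; congr (_ * _).
rewrite (@horner_coef_wide _ (\sum_(k0 < q) (x k0 == x k))%N) //.
apply: leq_trans (sP k) _; rewrite /node_order.
have -> : (\sum_(i < q) (x i == x k) = \sum_(0 <= i < q) (x i == x k))%N.
  by rewrite big_mkord.
rewrite (big_cat_nat (leq0n k) (ltnW (ltn_ord k))) /= big_mkord -addn1.
by rewrite leq_add // big_ltn // eqxx.
Qed.

Lemma prod_const_count (R : comNzRingType) (b : R) (P : nat -> bool) (n : nat) :
  \prod_(k < n | P k) b = b ^+ (\sum_(k < n) P k)%N.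
Proof.
elim: n => [|n IH]; first by rewrite !big_ord0.
rewrite big_mkcond big_ord_recr /= -big_mkcond /= IH big_ord_recr /=.
by case: (P n); rewrite ?mulr1 ?addn0 // addn1 exprSr.
Qed.

(** Extension to all natural numbers of a family indexed by ['I_q]. *)
Definition ext_ord (q : nat) (T : Type) (c : 'I_q -> T) (i : nat) : option T :=
  omap c (insub i).

Lemma ext_ordE (q : nat) (T : Type) (c : 'I_q -> T) (j : 'I_q) :
  ext_ord c j = Some (c j).
Proof. by rewrite /ext_ord valK. Qed.

(** The node of order [l] among the rows assigned to the group [g]. *)
Definition group_node (R : nmodType) (q : nat) (T : eqType) (c : 'I_q -> T)
    (N : nat -> R) (g : T) (l : nat) : R :=
  \sum_(i < q | (c i == g) && (node_order (ext_ord c) i == l)) N i.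

Lemma group_nodeE (R : nmodType) (q : nat) (T : eqType) (c : 'I_q -> T)
    (N : nat -> R) (j : 'I_q) :
  group_node c N (c j) (node_order (ext_ord c) j) = N j.
Proof.
rewrite /group_node (big_pred1 j) // => i.
apply/andP/eqP => [[/eqP ci /eqP o]|->].
  by apply: val_inj; apply: node_order_inj o; rewrite !ext_ordE ci.
by rewrite !eqxx.
Qed.

(** With the nodes of its own group, a Newton polynomial of degree [e] at the
    row [j] is at most the product of the differences with the smaller rows of
    the group: it vanishes if [e] exceeds the number of these rows. *)
Lemma group_newton_le (R : realDomainType) (q : nat) (T : eqType)
    (c : 'I_q -> T) (N : nat -> R) (j : 'I_q) (e : nat) :
  (forall k, (k < j)%N -> 1 <= N j - N k) ->
  `|\prod_(l < e) (N j - group_node c N (c j) l)| <=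
  \prod_(k < j | ext_ord c k == ext_ord c j) (N j - N k).
Proof.
move=> N1; have [re|er] := ltnP (node_order (ext_ord c) j) e.
  rewrite (bigD1 (Ordinal re)) //= group_nodeE subrr mul0r normr0.
  by apply: prodr_ge0 => k _; apply: le_trans (N1 _ _).
pose G l : R := if (l < e)%N then `|N j - group_node c N (c j) l| else 1.
rewrite normr_prod.
rewrite (big_ord_widen _ (fun l => `|N j - group_node c N (c j) l|) er).
rewrite big_mkcond /= -(@big_node_order _ (ext_ord c) _ _ _ G).
apply: ler_prod => k /eqP ck.
have kq : (k < q)%N by apply: ltn_trans (ltn_ord j).
have cE : c (Ordinal kq) = c j by apply: Some_inj; rewrite -!ext_ordE.
rewrite /G -cE -[nat_of_ord k]/(nat_of_ord (Ordinal kq)) group_nodeE /=.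
have Nk := N1 k (ltn_ord k); have Nk0 := le_trans ler01 Nk.
by case: ifP => _; rewrite ?ger0_norm ?Nk0 ?lexx ?ler01.
Qed.

(** The contribution of one assignment [c].  The weights [w] depend on the row
    and on the group; [b j] bounds from below the differences [N j - N k]. *)
Lemma det_masked_bound (R : realFieldType) (q : nat) (x : nat -> R) (A : pred R)
    (rep : 'I_q -> 'I_q) (c : 'I_q -> 'I_q) (w : 'I_q -> R -> R)
    (N b : nat -> R) (K : R) (D : 'I_q -> 'I_q -> R) (p : 'I_q -> {poly R}) :
  (forall k k' : 'I_q, (rep k == rep k') = (x k == x k')) ->
  (forall k, 1 <= b k) ->
  (forall j k, (j < k < q)%N -> b j <= b k) ->
  (forall j k, (k < j < q)%N -> b j <= N j - N k) ->
  1 <= K ->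
  (forall j k : 'I_q, A (x k) -> D j k = w j (x k) * (p k).[N j]) ->
  (forall j k : 'I_q, A (x k) -> `|w j (x k)| <= 1) ->
  (forall k : 'I_q, (size (p k) <= (node_order x k).+1)%N) ->
  (forall k : 'I_q, `|(p k)`_(node_order x k)| <= K) ->
  (forall j k : 'I_q, ~~ A (x k) -> `|D j k| <= K * b j ^+ node_order x k) ->
  `|\det (\matrix_(j, k) ((c j == rep k)%:R * D j k))| <=
  q`!%:R * (K ^+ q * K ^+ q) *
  \prod_(j < q) \prod_(k < j | ext_ord c k == ext_ord c j) (N j - N k).
Proof.
move=> repE b1 bM bN K1 DA w1 sp pK DB.
have K0 : 0 <= K by apply: le_trans K1.
have b0 k : 0 <= b k by apply: le_trans (b1 k).
have N1 (j : 'I_q) k : (k < j)%N -> 1 <= N j - N k.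
  by move=> kj; apply: le_trans (b1 j) (bN _ _ _); rewrite kj ltn_ord.
pose T (j : 'I_q) := \prod_(k < j | ext_ord c k == ext_ord c j) (N j - N k).
have T1 j : 1 <= T j by apply: prodr_ege1 => k _; apply: N1.
pose h j k := c j == rep k.
have hx j (k k' : 'I_q) : x k = x k' -> h j k = h j k'.
  by move=> /eqP; rewrite -repE /h => /eqP ->.
pose M (P : 'I_q -> {poly R}) := \matrix_(j < q, k < q) ((h j k)%:R *
    (if A (x k) then w j (x k) * (P k).[N j] else D j k)).
have -> : \matrix_(j, k) ((c j == rep k)%:R * D j k) = M p.
  by apply/matrixP => j k; rewrite !mxE; case: ifP => // /DA ->.
pose z := group_node c N.
pose p' (k : 'I_q) : {poly R} :=
  \prod_(l < node_order x k) ('X - (z (rep k) l)%:P).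
have sp' k : size (p' k) = (node_order x k).+1.
  by rewrite size_prod_XsubC /index_enum unlock -enumT size_enum_ord.
have lp' k : (p' k)`_(node_order x k) = 1.
  have /monicP : p' k \is monic by apply: monic_prod_XsubC.
  by rewrite lead_coefE sp'.
have bound' : `|\det (M p')| <= q`!%:R * (K ^+ q * \prod_j T j).
  apply: det_le_prod => s.
  have [/forallP hs|] := boolP [forall j, h j (s j)]; last first.
    case/forallPn => j /negPf hj.
    rewrite (bigD1 j) //= mxE hj mul0r normr0 mul0r mulr_ge0 ?exprn_ge0 //.
    by apply: prodr_ge0 => i _; apply: le_trans (T1 i).
  pose E (j : 'I_q) := if A (x (s j)) then T j else b j ^+ node_order x (s j).
  have E0 j : 0 <= E j.
    by rewrite /E; case: ifP => _; rewrite ?exprn_ge0 // (le_trans _ (T1 j)).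
  apply: (@le_trans _ _ (\prod_j (K * E j))).
    apply: ler_prod => j _; rewrite normr_ge0 mxE hs mul1r /E /=.
    case: ifP => As; last by apply: DB; rewrite As.
    rewrite normrM horner_prod.
    under eq_bigr do rewrite !hornerE.
    apply: ler_pM => //; first exact: le_trans (w1 _ _ As) K1.
    rewrite -(eqP (hs j)); apply: group_newton_le => k; exact: N1.
  rewrite big_split /= prodr_const card_ord ler_wpM2l ?exprn_ge0 //.
  rewrite (partition_big c predT) // [leRHS](partition_big c predT) //=.
  apply: ler_prod => g _; rewrite prodr_ge0 //=.
  have [j0 /eqP cj0|nog] := pickP (fun j => c j == g); last first.
    by rewrite !big_pred0.
  have xs j : (c j == g) = (x (s j) == x (s j0)).
    by rewrite -repE -(eqP (hs j)) -(eqP (hs j0)) cj0.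
  rewrite (eq_bigr (fun j => if A (x (s j0)) then T j else
      b j ^+ node_order x (s j))) => [|j]; last by rewrite xs /E => /eqP ->.
  case: (A (x (s j0))) => //.
  (* The orders of the columns taken by the rows of a group are a permutation
     of the ranks of these rows. *)
  apply: (@le_trans _ _ (\prod_(j | c j == g) b j ^+ node_order (ext_ord c) j)).
    pose S := [set j | c j == g].
    have toS (F : 'I_q -> R) : \prod_(j | c j == g) F j = \prod_(j in S) F j.
      by apply: eq_bigl => j; rewrite inE.
    rewrite !toS.
    apply: (@prod_exp_rearrange R 'I_q S b (fun j => node_order x (s j))) => //.
      move=> j k; rewrite !inE => /eqP cj /eqP ck jk.
      have [jk'|kj|/ord_inj -> //] := ltngtP (j : nat) k.
        by apply: bM; rewrite jk' ltn_ord.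
      have := @node_order_lt _ (ext_ord c) _ _ kj.
      by rewrite !ext_ordE cj ck ltnNge (ltnW jk) => /(_ erefl).
    move=> l; have cnt (r : 'I_q -> nat) :
        #|[set j in S | (l < r j)%N]| = (\sum_(j | c j == g) (l < r j))%N.
      by rewrite -sum1_card big_mkcond [RHS]big_mkcond; apply: eq_bigr => j _;
        rewrite !inE; case: (c j == g) => //; case: ltnP.
    rewrite !cnt.
    have -> : (\sum_(j | c j == g) (l < node_order x (s j)) =
        \sum_(k < q | x k == x (s j0)) (l < node_order x k))%N.
      rewrite [RHS](reindex_inj (@perm_inj _ s)) /=.
      by apply: eq_bigl => j; rewrite xs.
    have -> : (\sum_(j | c j == g) (l < node_order (ext_ord c) j) =
        \sum_(j < q | ext_ord c j == Some g) (l < node_order (ext_ord c) j))%N.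
      by apply: eq_bigl => j; rewrite ext_ordE.
    rewrite (@big_node_order _ x nat 0%N addn (fun i => nat_of_bool (l < i)%N)).
    rewrite (@big_node_order _ (ext_ord c) nat 0%N addn
      (fun i => nat_of_bool (l < i)%N)).
    have -> // : (\sum_(k < q) (x k == x (s j0)) =
        \sum_(k < q) (ext_ord c k == Some g))%N.
    rewrite (reindex_inj (@perm_inj _ s)) /=; apply: eq_bigr => j _.
    by rewrite ext_ordE -xs.
  apply: ler_prod => j _; rewrite exprn_ge0 //=.
  rewrite -[leLHS](@prod_const_count _ _ (fun k => ext_ord c k == ext_ord c j)).
  apply: ler_prod => k _; rewrite b0 /=; apply: bN.
  by rewrite !ltn_ord.
have sp'' k : (size (p' k) <= (node_order x k).+1)%N by rewrite sp'.
have e1 := @det_column_poly R q x A h w (fun j => N j) D p hx sp.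
have := @det_column_poly R q x A h w (fun j => N j) D p' hx sp''.
rewrite [X in _ * X]big1 => [|k _]; last by rewrite lp'; case: ifP.
rewrite mulr1 => e2; rewrite -/(M p) -/(M p') in e1 e2.
rewrite {}e1 -{}e2 normrM [leLHS]mulrC.
have kap : `|\prod_(k < q) (if A (x k) then (p k)`_(node_order x k) else 1)|
    <= K ^+ q.
  rewrite normr_prod -[q in K ^+ q]card_ord -prodr_const.
  apply: ler_prod => k _; rewrite normr_ge0 /=; case: ifP => _ //.
  by rewrite normr1.
rewrite [leRHS](_ : _ = K ^+ q * (q`!%:R * (K ^+ q * \prod_j T j))).
  exact: ler_pM.
by rewrite /T; ring.
Qed.

(** Hypotheses on a matrix [D] whose columns are grouped by the values of the
    nodes [x].  A column of order [e] in its group is, if the group satisfies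
    [A], a polynomial of degree at most [e] in [N] weighted row by row, and
    otherwise at most [b ^+ e].  The rows are sorted by increasing [N]. *)
Record grouped_columns (R : realFieldType) (q : nat) (x : nat -> R) (A : pred R)
    (w : 'I_q -> R -> R) (N b : nat -> R) (K : R) (D : 'I_q -> 'I_q -> R)
    (p : 'I_q -> {poly R}) : Prop := GroupedColumns {
  gc_b1 : forall k, 1 <= b k;
  gc_bM : forall j k, (j < k < q)%N -> b j <= b k;
  gc_bN : forall j k, (k < j < q)%N -> b j <= N j - N k;
  gc_K1 : 1 <= K;
  gc_poly : forall j k : 'I_q, A (x k) -> D j k = w j (x k) * (p k).[N j];
  gc_weight : forall j k : 'I_q, A (x k) -> `|w j (x k)| <= 1;
  gc_size : forall k : 'I_q, (size (p k) <= (node_order x k).+1)%N;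
  gc_lead : forall k : 'I_q, `|(p k)`_(node_order x k)| <= K;
  gc_small : forall j k : 'I_q,
    ~~ A (x k) -> `|D j k| <= K * b j ^+ node_order x k }.

(** The bound obtained by summing over all assignments and all permutations. *)
Definition group_const (R : realFieldType) (q : nat) (K : R) : R :=
  #|{ffun 'I_q -> 'I_q}|%:R * (q`!%:R * (K ^+ q * K ^+ q)).

(** A canonical index with the same node as [k]; it labels the group of [k]. *)
Definition node_rep (T : eqType) (q : nat) (x : nat -> T) (k : 'I_q) : 'I_q :=
  odflt k [pick i : 'I_q | x i == x k].

Lemma node_repE (T : eqType) (q : nat) (x : nat -> T) (k k' : 'I_q) :
  (node_rep x k == node_rep x k') = (x k == x k').
Proof.
have xr (i : 'I_q) : x (node_rep x i) = x i.
  by rewrite /node_rep; case: pickP => [j /eqP|/(_ i)] //=; rewrite eqxx.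
apply/eqP/eqP => [e|e]; first by rewrite -(xr k) e xr.
rewrite /node_rep e; case: pickP => [//|/(_ k)]; first by rewrite e eqxx.
Qed.

Lemma det_grouped_sum (R : realFieldType) (q : nat) (x : nat -> R) (A : pred R)
    (w : 'I_q -> R -> R) (N b : nat -> R) (K : R) (D : 'I_q -> 'I_q -> R)
    (p : 'I_q -> {poly R}) (W B : R) :
  grouped_columns x A w N b K D p -> 0 <= W ->
  (forall c : {ffun 'I_q -> 'I_q},
    \det (\matrix_(j, k) ((c j == node_rep x k)%:R * D j k)) = 0 \/
    \prod_(j < q) \prod_(k < j | ext_ord c k == ext_ord c j) (N j - N k) * W
      <= B) -> 0 <= B ->
  `|\det (\matrix_(j, k) D j k)| * W <= group_const q K * B.
Proof.
move=> g W0 h B0; rewrite (det_mask (node_rep x)).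
have K0 : 0 <= K by apply: le_trans (gc_K1 g).
apply: le_trans (ler_wpM2r W0 (ler_norm_sum _ _ _)) _; rewrite mulr_suml.
pose L := q`!%:R * (K ^+ q * K ^+ q).
have L0 : 0 <= L by rewrite !mulr_ge0 // ?exprn_ge0.
apply: (@le_trans _ _ (\sum_(c : {ffun 'I_q -> 'I_q}) L * B)); last first.
  by rewrite sumr_const -mulr_natl /group_const mulrA.
apply: ler_sum => c _; have [->|hc] := h c.
  by rewrite normr0 mul0r mulr_ge0.
apply: (@le_trans _ _ (L * (\prod_(j < q)
    \prod_(k < j | ext_ord c k == ext_ord c j) (N j - N k) * W)));
  last exact: ler_wpM2l.
rewrite mulrA; apply: ler_wpM2r => //.
case: g => *.
apply: (@det_masked_bound _ _ x A (node_rep x) c w N b K D p) => //.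
by move=> *; exact: node_repE.
Qed.

Lemma det_grouped_bound (R : realFieldType) (q : nat) (x : nat -> R)
    (A : pred R) (w : 'I_q -> R -> R) (N b : nat -> R) (K : R)
    (D : 'I_q -> 'I_q -> R) (p : 'I_q -> {poly R}) :
  grouped_columns x A w N b K D p ->
  `|\det (\matrix_(j, k) D j k)| <=
  group_const q K * \prod_(j < q) \prod_(k < j) (N j - N k).
Proof.
move=> g; rewrite -[leLHS]mulr1.
have N1 (j : 'I_q) (k : nat) : (k < j)%N -> 1 <= N j - N k.
  move=> kj; apply: le_trans (gc_b1 g j) (gc_bN g _).
  by rewrite kj ltn_ord.
have N0 (j : 'I_q) (k : nat) : (k < j)%N -> 0 <= N j - N k.
  by move=> kj; apply: le_trans (N1 _ _ kj).
apply: (det_grouped_sum g) => //; last first.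
  by apply: prodr_ge0 => j _; apply: prodr_ge0 => k _; apply: N0.
move=> c; right; rewrite mulr1; apply: ler_prod => j _.
rewrite prodr_ge0 => [|k _]; last exact: N0.
rewrite big_mkcond; apply: ler_prod => k _.
by case: ifP => _; rewrite ?ler01 ?N1 ?N0 ?lexx.
Qed.

(** With at least two groups of columns every assignment that contributes
    separates some rows, and the missing differences give a gain. *)
Lemma det_grouped_gain (R : realFieldType) (q : nat) (x : nat -> R)
    (A : pred R) (w : 'I_q.+1 -> R -> R) (N b : nat -> R) (K : R)
    (D : 'I_q.+1 -> 'I_q.+1 -> R) (p : 'I_q.+1 -> {poly R}) (k0 k1 : 'I_q.+1) :
  grouped_columns x A w N b K D p -> x k0 != x k1 ->
  `|\det (\matrix_(j, k) D j k)| * \prod_(k < q) b k.+1 <=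
  group_const q.+1 K * \prod_(j < q.+1) \prod_(k < j) (N j - N k).
Proof.
move=> g x01.
have N1 (j : 'I_q.+1) (k : nat) : (k < j)%N -> 1 <= N j - N k.
  move=> kj; apply: le_trans (gc_b1 g j) (gc_bN g _).
  by rewrite kj ltn_ord.
have N0 (j : 'I_q.+1) (k : nat) : (k < j)%N -> 0 <= N j - N k.
  by move=> kj; apply: le_trans (N1 _ _ kj).
have b0 k : 0 <= b k by apply: le_trans (gc_b1 g k).
apply: (det_grouped_sum g).
- by apply: prodr_ge0.
- move=> c; have [/forallP cE|] := boolP [forall j, c j == c ord0].
    (* A column of another group vanishes. *)
    left; have [k kc] : exists k, node_rep x k != c ord0.
      have [e|] := eqVneq (node_rep x k0) (c ord0); last by exists k0.
      by exists k1; rewrite -e node_repE eq_sym.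
    apply/eqP; rewrite -normr_le0 -[leRHS](mulr0 (q.+1)`!%:R).
    apply: det_le_prod => s; pose j := (s^-1)%g k.
    rewrite (bigD1 j) //= mxE /j permKV (eqP (cE _)) eq_sym (negPf kc).
    by rewrite mul0r normr0 mul0r.
  case/forallPn => i ci; right.
  apply: (@le_trans _ _ (
      \prod_(j < q.+1) \prod_(k < j | ext_ord c k == ext_ord c j) (N j - N k) *
      \prod_(j < q.+1) \prod_(k < j | ext_ord c k != ext_ord c j) (N j - N k)));
    last first.
    rewrite -big_split /=; apply: ler_prod => j _.
    rewrite [\prod_(_ < j) _](bigID
      (fun k : 'I_j => ext_ord c k == ext_ord c j)).
    by rewrite lexx andbT mulr_ge0 // prodr_ge0 // => k _; apply: N0.
  apply: ler_wpM2l.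
    by apply: prodr_ge0 => j _; apply: prodr_ge0 => k _; apply: N0.
  apply: le_trans (@prod_separated_ge _ _ (ext_ord c) b q _ _ _) _.
  - exact: gc_b1 g.
  - by move=> j k; rewrite -ltnS; apply: (gc_bM g).
  - exists i; first by rewrite -ltnS.
    rewrite ext_ordE -[0%N]/(nat_of_ord (@ord0 q)) ext_ordE.
    by apply: contra ci => /eqP [->].
  - apply: ler_prod => j _; rewrite prodr_ge0 //=.
    apply: ler_prod => k _; rewrite b0 /=; apply: (gc_bN g).
    by rewrite !ltn_ord.
- by apply: prodr_ge0 => j _; apply: prodr_ge0 => k _; apply: N0.
Qed.

(** * Confluent determinants of Jacobi polynomials *)

(** The eigenvalue of the Jacobi operator of parameters [(a, 0)] on the
    polynomial of degree [n]. *)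
Definition jac_eig (R : pzRingType) (a n : nat) : R := (n * (n + a.+1))%:R.

Lemma jac_eig_sub (R : realDomainType) (a m n : nat) : (m < n)%N ->
  n.+1%:R <= jac_eig R a n - jac_eig R a m.
Proof.
by move=> mn; rewrite /jac_eig lerBrDr -natrD ler_nat; nia.
Qed.

(** The value at [v], which is [1] or [-1], of the polynomial of degree [n]
    scaled by [s n]. *)
Definition jac_weight (R : realFieldType) (a : nat) (s : nat -> R) (n : nat)
    (v : R) : R :=
  s n * (if v == 1 then 'C(n + a, a)%:R else (-1) ^+ n).

(** The entries of the confluent determinant at the nodes [y], when the
    polynomial of degree [n] is scaled by [s n]. *)
Definition jac_entry (R : realFieldType) (a : nat) (s : nat -> R)
    (y : nat -> R) (n k : nat) : R :=
  s n * taylor (jacp R a 0 n) (y k) (node_order y k).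

(** The scaling [s] is only constrained by the nodes that occur, which leaves
    room to gain a power of the degree when all nodes coincide. *)
Lemma jac_grouped (R : rcfType) (a q : nat) (y : nat -> R) (s : nat -> R) :
  (forall k : 'I_q, `|y k| <= 1) ->
  (forall k : 'I_q, y k = 1 -> forall n, `|s n * 'C(n + a, a)%:R| <= 1) ->
  (forall k : 'I_q, y k = -1 -> forall n, `|s n| <= 1) ->
  (forall k : 'I_q, `|y k| < 1 -> forall n, `|s n| <= Num.sqrt n.+1%:R) ->
  exists K, forall n : nat -> nat,
  (forall j k, (j < k < q)%N -> (n j < n k)%N) ->
  exists p, grouped_columns y (fun v => `|v| == 1)
    (fun (j : 'I_q) => jac_weight a s (n j)) (fun i => jac_eig R a (n i))
    (fun i => (n i).+1%:R) K (fun j k : 'I_q => jac_entry a s y (n j) k) p.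
Proof.
move=> y1 s1 sN1 si.
pose Q e (v : R) : R := \prod_(l < e) (v - jac_eig R a l).
have : forall k : 'I_q, exists u : R,
    if `|y k| == 1 then forall n, jac_entry a s y n k =
      jac_weight a s n (y k) * (u * Q (node_order y k) (jac_eig R a n))
    else forall n, `|jac_entry a s y n k| <= u * n.+1%:R ^+ node_order y k.
  move=> k; rewrite /jac_entry /jac_weight.
  have [|yk] := boolP (`|y k| == 1); last first.
    have yk1 : `|y k| < 1 by rewrite lt_neqAle yk y1.
    have [C [C0 hC]] := taylor_jacp_bound a 0 (node_order y k) yk1.
    exists C => n; rewrite normrM mulrC.
    apply: le_trans (ler_pM _ _ (hC n) (si k yk1 n)) _ => //.
    by rewrite -mulrA divfK // sqrtr_eq0 -ltNge ltr0n.
  rewrite eqr_norml ler01 andbT => /orP[] /eqP yk; rewrite yk.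
    have [u hu] := taylor_jacp_at1 R a 0 (node_order y k).
    exists u => n; rewrite hu eqxx /Q /jac_eig addn0; ring.
  have [u hu] := taylor_jacp_atN1 R a 0 (node_order y k).
  exists u => n; rewrite hu /Q /jac_eig !addn0 bin0 mulr1.
  rewrite ifF; last by lra. ring.
move=> /fin_all_exists[u hu]; exists (1 + \sum_k `|u k|).
move=> n nM.
have uK k : `|u k| <= 1 + \sum_k `|u k|.
  by rewrite (bigD1 k) //= addrCA lerDl addr_ge0 // sumr_ge0.
exists (fun k => u k *: \prod_(l < node_order y k) ('X - (jac_eig R a l)%:P)).
have szQ e : size (\prod_(l < e) ('X - (jac_eig R a l)%:P)) = e.+1.
  by rewrite size_prod_XsubC /index_enum unlock -enumT size_enum_ord.
split.
- by move=> k; rewrite ler1n.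
- by move=> j k jk; rewrite ler_nat ltnS ltnW // nM.
- by move=> j k /andP[kj jq]; apply: jac_eig_sub; apply: nM; rewrite kj.
- by rewrite lerDl sumr_ge0.
- move=> j k yk; have := hu k; rewrite yk => ->; congr (_ * _).
  rewrite hornerZ horner_prod; congr (_ * _); apply: eq_bigr => l _.
  by rewrite !hornerE.
- move=> j k; rewrite eqr_norml ler01 andbT /jac_weight => /orP[] /eqP yk.
    by rewrite yk eqxx; apply: s1 yk _.
  rewrite normrM yk ifF; last by lra.
  by rewrite normrX normrN1 expr1n mulr1; apply: sN1 yk _.
- move=> k; apply: leq_trans (size_scale_leq _ _) _; by rewrite szQ.
- move=> k; rewrite coefZ; set P := \prod_(_ < _) _.
  have /monicP : P \is monic by apply: monic_prod_XsubC.
  by rewrite lead_coefE szQ /= => ->; rewrite mulr1.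
- move=> j k /negPf yk; have := hu k; rewrite yk => /(_ (n j)) h.
  apply: le_trans h _; apply: ler_wpM2r; first by rewrite exprn_ge0.
  exact: le_trans (ler_norm _) (uK k).
Qed.

(** * The formula at singular points *)

Local Open Scope classical_set_scope.
Local Open Scope ring_scope.

Lemma cos2_sub (R : realType) (a b : R) :
  cos (2 * a) - cos (2 * b) = - 2 * (sin (a + b) * sin (a - b)).
Proof.
have -> : 2 * a = (a + b) + (a - b) by ring.
have -> : 2 * b = (a + b) - (a - b) by ring.
by move: (a + b) (a - b) => x y; rewrite cosD cosB; ring.
Qed.

Lemma near_sin_neq0 (R : realType) (a b : R) : b != 0 ->
  \forall e \near (0 : R)^', sin (a + e * b) != 0.
Proof.
move=> b0; have [a0|a0] := eqVneq (sin a) 0; last first.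
  apply: cvgr_neq0 a0; apply: cvg_within_filter.
  have c : (fun e : R => a + e * b) @ (0 : R) --> a + 0 * b.
    apply: cvgD; first exact: cvg_cst.
    by apply: cvgM; [exact: cvg_id|exact: cvg_cst].
  rewrite mul0r addr0 in c.
  exact: (cvg_comp _ sin c (@continuous_sin R a)).
have : \forall e \near (0 : R)^', `|e| < pi / `|b|.
  by apply: dnbhs0_lt; rewrite divr_gt0 ?pi_gt0 // normr_gt0.
have : \forall e \near (0 : R)^', e != 0 by exact: nbhs_dnbhs_neq.
apply: filterS2 => e e0 eb.
have ca : cos a != 0.
  apply/eqP => ca; have := cos2Dsin2 a; rewrite a0 ca expr0n addr0.
  by move/eqP; rewrite eq_sym oner_eq0.
rewrite sinD a0 mul0r add0r mulf_neq0 //.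
have pos y : 0 < y < pi -> sin y != 0 by move=> /sin_gt0_pi/gt_eqF ->.
have eb1 : `|e * b| < pi by rewrite normrM -ltr_pdivlMr // normr_gt0.
have eb0 : e * b != 0 by rewrite mulf_neq0.
have [lt0|gt0|E] := ltgtP (e * b) 0.
- rewrite -oppr_eq0 -sinN pos // oppr_gt0 lt0 /=.
  by rewrite ltr0_norm in eb1.
- by rewrite pos // gt0 /=; rewrite gtr0_norm in eb1.
- by rewrite E eqxx in eb0.
Qed.

(** Density makes the limit in the Berezin-Karpelevich formula unique. *)
Lemma closure_distinct_cos (R : realType) (q : nat) (t : 'rV[R]_q) :
  closure (@distinct_cos R q) t.
Proof.
pose u : 'rV[R]_q := \row_j j.+1%:R.
pose s (e : R) : 'rV[R]_q := t + e *: u.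
have s_t : s @ (0 : R)^' --> t.
  apply: cvg_within_filter.
  have c : s @ (0 : R) --> t + 0 *: u.
    by apply: cvgD; [exact: cvg_cst|apply: cvgZr_tmp; exact: cvg_id].
  by rewrite scale0r addr0 in c.
have near_s : \forall e \near (0 : R)^', distinct_cos (s e).
  have : \forall e \near (0 : R)^', forall jk : 'I_q * 'I_q, jk.1 != jk.2 ->
      sin ((t 0 jk.1 + t 0 jk.2) + e * (jk.1.+1%:R + jk.2.+1%:R)) != 0 /\
      sin ((t 0 jk.1 - t 0 jk.2) + e * (jk.1.+1%:R - jk.2.+1%:R)) != 0.
    apply: filter_forall => -[j k] /=; have [->|jk] := eqVneq j k.
      by apply: nearW => e.
    have b1 : j.+1%:R + k.+1%:R != 0 :> R by rewrite -natrD pnatr_eq0.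
    have b2 : j.+1%:R - k.+1%:R != 0 :> R by rewrite subr_eq0 eqr_nat eqSS.
    have h1 := near_sin_neq0 (t 0 j + t 0 k) b1.
    by apply: filterS2 h1 (near_sin_neq0 (t 0 j - t 0 k) b2) => e.
  apply: filterS => e h j k jk; rewrite -subr_eq0 cos2_sub.
  have /= [h1 h2] := h (j, k) jk.
  rewrite mulf_neq0 ?oppr_eq0 ?pnatr_eq0 // /s /u !mxE.
  have e1 : t 0 j + e * j.+1%:R + (t 0 k + e * k.+1%:R) =
    t 0 j + t 0 k + e * (j.+1%:R + k.+1%:R) by ring.
  have e2 : t 0 j + e * j.+1%:R - (t 0 k + e * k.+1%:R) =
    t 0 j - t 0 k + e * (j.+1%:R - k.+1%:R) by ring.
  by rewrite e1 e2 mulf_neq0.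
move=> B tB; have near_B : \forall e \near (0 : R)^', B (s e) by exact: s_t tB.
have : \forall e \near (0 : R)^', distinct_cos (s e) /\ B (s e).
  by apply: filterS2 near_s near_B => e; split.
move=> /(@filter_ex _ _ (Proper_dnbhs_numFieldType (0 : R)))[e [se Be]].
by exists (s e).
Qed.

Lemma cvg_bigsum (R : realType) (T : Type) (F : set_system T) {FF : Filter F}
    (I : Type) (r : seq I) (f : I -> T -> R) (l : I -> R) :
  (forall i, f i @ F --> l i) ->
  (fun x => \sum_(i <- r) f i x) @ F --> \sum_(i <- r) l i.
Proof.
move=> fl; elim: r => [|i r IH].
  rewrite big_nil (_ : (fun _ => _) = fun=> 0); first exact: cvg_cst.
  by apply/funext => x; rewrite big_nil.
rewrite big_cons (_ : (fun _ => _) = f i \+ (fun x => \sum_(i <- r) f i x)).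
  exact: cvgD.
by apply/funext => x; rewrite big_cons.
Qed.

Lemma cvg_bigprod (R : realType) (T : Type) (F : set_system T) {FF : Filter F}
    (I : Type) (r : seq I) (f : I -> T -> R) (l : I -> R) :
  (forall i, f i @ F --> l i) ->
  (fun x => \prod_(i <- r) f i x) @ F --> \prod_(i <- r) l i.
Proof.
move=> fl; elim: r => [|i r IH].
  rewrite big_nil (_ : (fun _ => _) = fun=> 1); first exact: cvg_cst.
  by apply/funext => x; rewrite big_nil.
rewrite big_cons (_ : (fun _ => _) = f i \* (fun x => \prod_(i <- r) f i x)).
  exact: cvgM.
by apply/funext => x; rewrite big_cons.
Qed.

Lemma cvg_det (R : realType) (T : Type) (F : set_system T) {FF : Filter F}
    (q : nat) (f : 'I_q -> 'I_q -> T -> R) (l : 'I_q -> 'I_q -> R) :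
  (forall i j, f i j @ F --> l i j) ->
  (fun x => \det (\matrix_(i, j) f i j x)) @ F --> \det (\matrix_(i, j) l i j).
Proof.
move=> fl; apply: cvg_bigsum => s; apply: cvgM; first exact: cvg_cst.
rewrite (_ : (fun _ => _) = fun x => \prod_(i < q) f i (s i) x); last first.
  by apply/funext => x; apply: eq_bigr => i _; rewrite mxE.
rewrite (eq_bigr (fun i : 'I_q => l i (s i))) => [|i _]; last by rewrite mxE.
by apply: cvg_bigprod => i; apply: fl.
Qed.

Lemma cvg_divdiff (R : realType) (T : Type) (F : set_system T) {FF : Filter F}
    (x : nat -> T -> R) (y : nat -> R) (f : {poly R}) (l : nat) :
  (forall i, x i @ F --> y i) ->
  (fun s => divdiff (x^~ s) f l) @ F --> divdiff y f l.
Proof.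
move=> xy; apply: cvg_bigsum => i; apply: cvgM; first exact: cvg_cst.
elim: (i : nat) l => [|m IH] l /=; first exact: cvg_cst.
apply: cvgB; first by apply: cvgM; [exact: xy|exact: IH].
by case: l => [|l]; [exact: cvg_cst|exact: IH].
Qed.

(** The nodes [cos (2 t_k)], as a sequence. *)
Definition cos_nodes (R : realType) (q : nat) (t : 'rV[R]_q) (i : nat) : R :=
  odflt 0 (ext_ord (fun k => cos (2 * t 0 k)) i).

Lemma cos_nodesE (R : realType) (q : nat) (t : 'rV[R]_q) (k : 'I_q) :
  cos_nodes t k = cos (2 * t 0 k).
Proof. by rewrite /cos_nodes ext_ordE. Qed.

Lemma cvg_cos_nodes (R : realType) (q : nat) (t : 'rV[R]_q) (i : nat) :
  cos_nodes s i @[s --> nbhs t] --> cos_nodes t i.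
Proof.
have [iq|qi] := ltnP i q; last first.
  have nodes0 (s : 'rV[R]_q) : cos_nodes s i = 0 :> R.
    by rewrite /cos_nodes /ext_ord insubN // -leqNgt.
  by under eq_fun do rewrite nodes0; rewrite nodes0; exact: cvg_cst.
pose k := Ordinal iq.
have nodesk (s : 'rV[R]_q) : cos_nodes s i = cos (2 * s 0 k) :> R.
  by rewrite -cos_nodesE.
under eq_fun do rewrite nodesk; rewrite nodesk.
have c : (fun s : 'rV[R]_q => 2 * s 0 k) @ nbhs t --> 2 * t 0 k.
  by apply: cvgM; [exact: cvg_cst|exact: coord_continuous].
exact: (cvg_comp _ cos c (@continuous_cos R _)).
Qed.

(** The Jacobi polynomial of parameters [(a, 0)], normalized at 1. *)
Definition bk_poly (R : realType) (a n : nat) : {poly R} :=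
  ('C(n + a, a)%:R)^-1 *: jacp R a 0 n.

(** The factor of the Berezin-Karpelevich formula that does not depend on
    [t]. *)
Definition bk_const (R : realType) (p q : nat) (m : 'I_q -> nat) : R :=
  (BK_const p q)%:R / \prod_(j < q) \prod_(k < q | (j < k)%N)
    (jac_eig R (p - q) (shifted m j) - jac_eig R (p - q) (shifted m k)).

(** The Berezin-Karpelevich formula with the quotient of the determinant by the
    Vandermonde product of the nodes replaced by the determinant of divided
    differences: it makes sense for all [t] and is continuous. *)
Definition bk_ext (R : realType) (p q : nat) (m : 'I_q -> nat)
    (t : 'rV[R]_q) : R :=
  bk_const R p m * \det (\matrix_(j < q, l < q)
    divdiff (cos_nodes t) (bk_poly R (p - q) (shifted m j)) l).

Lemma jacobi_horner (R : realType) (a b n : nat) (x : R) :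
  jacobi a b n x = (jacp R a b n).[x].
Proof.
rewrite horner_jacp /jacobi /hform; apply: eq_bigr => s _.
have sn : (s <= n)%N by rewrite -ltnS.
rewrite /jac_coef natrM -['C(n + a, a + s)]bin_sub; last by lia.
by rewrite (_ : (n + a - (a + s) = n - s)%N) ?mulrA //; lia.
Qed.

Lemma bk_polyE (R : realType) (a n : nat) (x : R) :
  jacobi_normalized a 0 n x = (bk_poly R a n).[x].
Proof.
by rewrite /jacobi_normalized !jacobi_horner jacp_at1 /bk_poly hornerZ mulrC.
Qed.

Lemma distinct_nodes (R : realType) (q : nat) (t : 'rV[R]_q) (k i : nat) :
  distinct_cos t -> (i < k)%N -> (k < q)%N -> cos_nodes t i != cos_nodes t k.
Proof.
move=> dt ik kq; have iq := ltn_trans ik kq.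
rewrite -[ i ]/(nat_of_ord (Ordinal iq)) -[k]/(nat_of_ord (Ordinal kq)).
by rewrite !cos_nodesE; apply: dt; rewrite -val_eqE /= ltn_eqF.
Qed.

Lemma distinct_node_order (R : realType) (q : nat) (t : 'rV[R]_q) (k : 'I_q) :
  distinct_cos t -> node_order (cos_nodes t) k = 0%N.
Proof.
move=> dt; rewrite /node_order big1 // => i _.
by rewrite (negPf (distinct_nodes dt _ _)).
Qed.

Lemma BK_quotientE (R : realType) (p q : nat) (m : 'I_q -> nat) (t : 'rV[R]_q) :
  distinct_cos t -> BK_quotient p m t = bk_ext p m t.
Proof.
move=> dt; rewrite /BK_quotient.
have node k i := @distinct_nodes _ _ t k i dt.
have o0 (k : 'I_q) := distinct_node_order k dt.
have -> : \det (\matrix_(j < q, k < q)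
    jacobi_normalized (p - q) 0 (shifted m j) (cos (2 * t 0 k))) =
  \det (\matrix_(j < q, k < q) taylor (bk_poly R (p - q) (shifted m j))
    (cos_nodes t k) (node_order (cos_nodes t) k)).
  congr (\det _); apply/matrixP => j k.
  by rewrite !mxE bk_polyE o0 taylor0 cos_nodesE.
rewrite det_taylor_divdiff.
have -> : \prod_(k < q) node_pivot (cos_nodes t) k =
    \prod_(j < q) \prod_(k < q | (j < k)%N) (cos (2 * t 0 j) - cos (2 * t 0 k)).
  rewrite (exchange_big_dep predT) //=; apply: eq_bigr => k _.
  rewrite /node_pivot o0 mul1r.
  rewrite [LHS](eq_bigl xpredT) => [|i]; last by rewrite /= node.
  rewrite (big_ord_widen q (fun i => cos_nodes t i - cos_nodes t k))
    ?(ltnW (ltn_ord k)) //.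
  by apply: eq_bigr => i _; rewrite !cos_nodesE.
set V := \prod_(j < q) _; have V0 : V != 0.
  apply/prodf_neq0 => j _; apply/prodf_neq0 => k jk.
  by rewrite subr_eq0; apply: dt; rewrite -val_eqE /= ltn_eqF.
rewrite /bk_ext /bk_const.
pose W : R := \prod_(j < q) \prod_(k < q | (j < k)%N)
  (jac_eig R (p - q) (shifted m j) - jac_eig R (p - q) (shifted m k)).
set d := \det _; set b := _%:R; rewrite -/W.
rewrite [X in _ / X = _](_ : _ = V * W); last first.
  rewrite /V /W -[RHS]big_split; apply: eq_bigr => j _ /=.
  by rewrite -[RHS]big_split.
rewrite invfM -[RHS]mulrA -[LHS]mulrA; congr (_ * _).
by rewrite [d * V]mulrC mulrACA mulfV // mul1r mulrC.
Qed.

Lemma cvg_bk_ext (R : realType) (p q : nat) (m : 'I_q -> nat) (t : 'rV[R]_q) :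
  bk_ext p m s @[s --> nbhs t] --> bk_ext p m t.
Proof.
apply: cvgM; first exact: cvg_cst.
apply: (@cvg_det R _ _ _ q (fun j l s => divdiff (cos_nodes s) _ l)) => j l.
apply: (@cvg_divdiff R _ _ _ (fun i s => cos_nodes s i)) => i.
exact: cvg_cos_nodes.
Qed.

Lemma normc_real (R : rcfType) (x : R) : `|x%:C%C| = `|x|%:C%C.
Proof. by rewrite normc_def /= expr0n addr0 sqrtr_sqr. Qed.

Lemma cvg_real_complex (R : realType) (T : Type) (F : set_system T)
    {FF : Filter F} (f : T -> R) (l : R) :
  f @ F --> l -> (fun s => (f s)%:C%C) @ F --> l%:C%C.
Proof.
move=> fl; apply/cvgrPdist_lt => e e0.
have [eR eI] : 0 < complex.Re e /\ complex.Im e = 0.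
  by move: e0; rewrite ltcE /= => /andP[/eqP].
have /cvgrPdist_lt/(_ _ eR) := fl; apply: filterS => s.
rewrite -rmorphB normc_real => h.
by case: e eR eI h {e0} => er ei /= _ -> h; rewrite ltcR.
Qed.

Lemma Berezin_Karpelevich_ext (R : realType) (p q : nat) (m : 'I_q -> nat)
    (phi : 'M[R[i]]_(p + q) -> R[i]) (t : 'rV[R]_q) :
  Berezin_Karpelevich m phi -> phi (expiX p t) = (bk_ext p m t)%:C%C.
Proof.
move=> [_ /(_ t) h].
have PF : ProperFilter (within (@distinct_cos R q) (nbhs t)).
  exact/within_nbhs_proper/closure_distinct_cos.
have h' : (BK_quotient p m s)%:C%C
    @[s --> within (@distinct_cos R q) (nbhs t)] --> (bk_ext p m t)%:C%C.
  have : (bk_ext p m s)%:C%C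
      @[s --> within (@distinct_cos R q) (nbhs t)] --> (bk_ext p m t)%:C%C.
    by apply: cvg_within_filter; apply: cvg_real_complex; exact: cvg_bk_ext.
  apply: cvg_trans; apply: near_eq_cvg; rewrite near_withinE.
  apply: nearW => s ds.
  by rewrite BK_quotientE.
by apply: cvg_unique h h'; exact: norm_hausdorff.
Qed.

(** * The exponential of [i X] *)

Lemma cvg_mx_entries (T : Type) (F : set_system T) {FF : Filter F}
    (K : ptopologicalType) (m n : nat) (f : T -> 'M[K]_(m, n))
    (E : 'M[K]_(m, n)) :
  (forall a b, (fun s => f s a b) @ F --> E a b) -> f @ F --> E.
Proof.
move=> h U [P EP PU].
have : \forall s \near F, forall a b, P a b (f s a b).
  apply: filter_forall => a; apply: filter_forall => b.
  by apply: h; apply: EP.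
by apply: filterS => s Ps; apply: PU.
Qed.

Lemma expmx_cvg (R : realType) (n : nat) (A E : 'M[R[i]]_n) :
  (forall a b, (series (fun k : nat => (k`!%:R : R[i])^-1 * (A ^+ k) a b)) @ \oo
     --> E a b) ->
  expmx A = E.
Proof.
move=> h; apply: cvg_lim; first exact: norm_hausdorff.
apply: cvg_mx_entries => a b; have := h a b.
rewrite (_ : series _ =
  fun s => series (fun k : nat => k`!%:R^-1 *: A ^+ k) s a b) //.
apply/funext => s; rewrite /series /= summxE.
by apply: eq_bigr => k _; rewrite mxE.
Qed.

(** The two hypotheses say that [J] commutes with the diagonal matrix of [tau]
    and squares to the identity on the support of [tau]. *)
Lemma expmx_scaled_involution (R : realType) (n : nat) (tau : 'I_n -> R)
    (J : 'M[R[i]]_n) :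
  (forall a b, J a b = 0 \/ tau a = tau b) ->
  (forall a b, tau a != 0 -> (J *m J) a b = (a == b)%:R) ->
  expmx ('i%C *: \matrix_(a, b) ((tau a)%:C%C * J a b)) =
  \matrix_(a, b) ((cos (tau a))%:C%C * (a == b)%:R +
                  'i%C * (sin (tau a))%:C%C * J a b).
Proof.
move=> J1 J2; set X := _ *: _; pose c a := 'i%C * (tau a)%:C%C.
have XE k a b : (X ^+ k) a b =
    c a ^+ k * (if odd k then J a b else (a == b)%:R).
  elim: k b => [|k IH] b; first by rewrite expr0 mul1r mxE.
  rewrite exprSr [LHS]mxE.
  have -> : \sum_j (X ^+ k) a j * X j b = \sum_j c a ^+ k.+1 *
      ((if odd k then J a j else (a == j)%:R) * J j b).
    apply: eq_bigr => j _; rewrite IH !mxE exprSr.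
    have [->|ta] : (if odd k then J a j else (a == j)%:R) = 0 \/ tau a = tau j.
      by case: odd => //; case: eqP => [->|_]; [right|left].
    + by rewrite mulr0 !mul0r mulr0.
    + by rewrite /c -ta; ring.
  rewrite -mulr_sumr /=; case: (odd k) => /=.
    have [ta|ta] := eqVneq (tau a) 0.
      by rewrite /c ta mulr0 exprS !mul0r.
    by rewrite -J2 // mxE.
  congr (_ * _); rewrite (bigD1 a) //= eqxx mul1r big1 ?addr0 // => j.
  by rewrite eq_sym => /negPf ->; rewrite mul0r.
apply: expmx_cvg => a b; rewrite mxE.
have termE k : (k`!%:R : R[i])^-1 * (X ^+ k) a b =
   (cos_coeff (tau a) k)%:C%C * (a == b)%:R +
   'i%C * (sin_coeff (tau a) k)%:C%C * J a b.
  rewrite XE /c exprMn /cos_coeff /sin_coeff /=.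
  have f0 : (k`!%:R : R) != 0 by rewrite pnatr_eq0 -lt0n fact_gt0.
  have iE : ('i%C : R[i]) ^+ k = (-1) ^+ k./2 * (if odd k then 'i%C else 1).
    rewrite -{1}[k]odd_double_half exprD mulrC -mul2n exprM sqr_i.
    by case: odd; rewrite ?expr1.
  have hk : odd k -> k.-1./2 = k./2 by case: k {f0 iE} => [|k] //= ok; lia.
  rewrite iE -exprnP; case: (odd k) hk => [/(_ isT) ->|_] /=.
    rewrite !rmorphM /= fmorphV !rmorphXn /= rmorphN1 !rmorph_nat.
    by rewrite !(mul0r, add0r, mul1r); ring.
  rewrite !rmorphM /= fmorphV !rmorphXn /= rmorphN1 !rmorph_nat.
  by rewrite !(mul0r, mulr0, addr0); ring.
have seriesE s : series (fun k : nat => (k`!%:R : R[i])^-1 * (X ^+ k) a b) s =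
   (series (cos_coeff (tau a)) s)%:C%C * (a == b)%:R +
   'i%C * (series (sin_coeff (tau a)) s)%:C%C * J a b.
  rewrite /series /= (eq_bigr _ (fun k _ => termE k)) big_split /=.
  by rewrite -!mulr_suml -mulr_sumr !rmorph_sum.
have -> : series (fun k : nat => (k`!%:R : R[i])^-1 * (X ^+ k) a b) =
  fun s => (series (cos_coeff (tau a)) s)%:C%C * (a == b)%:R +
   'i%C * (series (sin_coeff (tau a)) s)%:C%C * J a b by apply/funext.
have cvgc := cvg_real_complex (@is_cvg_series_cos_coeff R (tau a)).
have cvgs := cvg_real_complex (@is_cvg_series_sin_coeff R (tau a)).
have -> : cos (tau a) = lim (series (cos_coeff (tau a)) @ \oo).
  by rewrite unlock.
have -> : sin (tau a) = lim (series (sin_coeff (tau a)) @ \oo).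
  by rewrite unlock.
apply: cvgD; first by apply: cvgM; [exact: cvgc|exact: cvg_cst].
apply: cvgM; last exact: cvg_cst.
by apply: cvgM; [exact: cvg_cst|exact: cvgs].
Qed.

(** The entry [(a, b)] lies on the anti-diagonal of one of the two off-diagonal
    blocks of [Xmx]. *)
Definition paired (p q a b : nat) : bool :=
  ((a < p <= b) || (b < p <= a))%N && (a + b == p + q.-1)%N.

(** The matrix [Xmx] at the point [(1, ..., 1)]. *)
Definition pair_mx (R : realType) (p q : nat) : 'M[R[i]]_(p + q) :=
  \matrix_(a, b) (paired p q a b)%:R.

(** The parameter that scales the row [a] of [Xmx]; it is [0] on the middle
    block. *)
Definition row_param (R : realType) (p q : nat) (t : 'rV[R]_q) (a : nat) : R :=
  odflt 0 (ext_ord (fun k => t 0 k) (if (a < p)%N then a else p + q.-1 - a)%N).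

Lemma row_paramD (R : realType) (p q : nat) (s t : 'rV[R]_q) (a : nat) :
  row_param p (s + t) a = row_param p s a + row_param p t a.
Proof.
rewrite /row_param /ext_ord; case: insub => [k|] /=; by rewrite ?mxE ?addr0.
Qed.

Lemma row_paramN (R : realType) (p q : nat) (t : 'rV[R]_q) (a : nat) :
  row_param p (- t) a = - row_param p t a.
Proof.
rewrite /row_param /ext_ord; case: insub => [k|] /=; by rewrite ?mxE ?oppr0.
Qed.

Lemma row_param_paired (R : realType) (p q : nat) (t : 'rV[R]_q) (a b : nat) :
  paired p q a b -> row_param p t a = row_param p t b.
Proof.
move=> /andP[ab /eqP e]; rewrite /row_param; congr (odflt 0 (ext_ord _ _)).
by case: ifP => ap; case: ifP => bp; lia.
Qed.

Lemma pair_mx_sqr (R : realType) (p q : nat) (t : 'rV[R]_q) (a b : 'I_(p + q)) :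
  (q <= p)%N -> row_param p t a != 0 ->
  (pair_mx R p q *m pair_mx R p q) a b = (a == b)%:R.
Proof.
move=> qp ta; have aq : ((if (a < p)%N then a : nat else p + q.-1 - a) < q)%N.
  move: ta; rewrite /row_param /ext_ord.
  by case: insubP => [k kq _ _|_] //; rewrite eqxx.
have cq : (p + q.-1 - a < p + q)%N by lia.
have aqp := ltn_ord a; have bqp := ltn_ord b.
rewrite mxE (bigD1 (Ordinal cq)) //= !mxE /= big1 => [|c cc].
  rewrite addr0 -natrM mulnb; congr (nat_of_bool _)%:R.
  by rewrite /paired -val_eqE /=; case: ifP aq => ap aq; lia.
rewrite !mxE -natrM mulnb; case: andP => // -[/andP[ac /eqP e] _].
by move: cc; rewrite -val_eqE /= => /eqP; lia.
Qed.

Lemma XmxE (R : realType) (p q : nat) (t : 'rV[R]_q) : (q <= p)%N ->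
  Xmx p t = \matrix_(a, b) ((row_param p t a)%:C%C * pair_mx R p q a b).
Proof.
move=> qp; apply/matrixP => a b; rewrite /Xmx [RHS]mxE [pair_mx _ _ _ _ _]mxE.
case: (split_ordP a) => i ->; case: (split_ordP b) => j ->;
  have := ltn_ord i; have := ltn_ord j => jl il;
  rewrite ?block_mxEul ?block_mxEur ?block_mxEdl ?block_mxEdr !mxE /paired /=.
- by rewrite (_ : _ && _ = false) ?mulr0 //; lia.
- rewrite il leq_addr /= addnCA eqn_add2l.
  case: eqP => [e|_]; rewrite ?mulr0 // mulr1 /row_param /= il.
  have iq : (i < q)%N by lia.
  rewrite (_ : nat_of_ord i = rev_ord j) ?ext_ordE //=; lia.
- rewrite jl leq_addr /= ltnNge leq_addr /= -addnA eqn_add2l.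
  case: eqP => [e|_]; rewrite ?mulr0 // mulr1 /row_param /= ltnNge leq_addr /=.
  rewrite (_ : (p + q.-1 - (p + i) = rev_ord i)%N) ?ext_ordE //=; lia.
- by rewrite (_ : _ && _ = false) ?mulr0 //; lia.
Qed.

Lemma expiXE (R : realType) (p q : nat) (t : 'rV[R]_q) : (q <= p)%N ->
  expiX p t = \matrix_(a, b) ((cos (row_param p t a))%:C%C * (a == b)%:R +
    'i%C * (sin (row_param p t a))%:C%C * pair_mx R p q a b).
Proof.
move=> qp; rewrite /expiX XmxE //.
apply: (@expmx_scaled_involution R _ (fun a => row_param p t a)) => a b.
  rewrite mxE; case: (boolP (paired p q a b)) => [ab|_]; last by left.
  by right; apply: row_param_paired ab.
exact: pair_mx_sqr.
Qed.

Lemma expiXD (R : realType) (p q : nat) (s t : 'rV[R]_q) : (q <= p)%N ->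
  expiX p (s + t) = expiX p s *m expiX p t.
Proof.
move=> qp; rewrite !expiXE //.
have [J EJ] : exists J, J = pair_mx R p q by exists (pair_mx R p q).
rewrite -EJ; apply/matrixP => a b; rewrite !mxE.
set C := fun u : 'rV[R]_q => (cos (row_param p u a))%:C%C : R[i].
set S := fun u : 'rV[R]_q => (sin (row_param p u a))%:C%C : R[i].
have JE c (f : R -> R) : J a c * (f (row_param p t c))%:C%C =
    J a c * (f (row_param p t a))%:C%C.
  rewrite EJ mxE; case: (boolP (paired p q a c)) => [ac|_]; last first.
    by rewrite !mul0r.
  by rewrite (row_param_paired t ac).
have -> : \sum_j (\matrix_(a, b) ((cos (row_param p s a))%:C%C * (a == b)%:R +
     'i%C * (sin (row_param p s a))%:C%C * J a b)) a j *
   (\matrix_(a, b) ((cos (row_param p t a))%:C%C * (a == b)%:R +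
     'i%C * (sin (row_param p t a))%:C%C * J a b)) j b =
  \sum_j (C s * ((a == j)%:R * ((cos (row_param p t j))%:C%C * (j == b)%:R +
     'i%C * (sin (row_param p t j))%:C%C * J j b)) +
   'i%C * S s * (C t * (J a j * (j == b)%:R) + 'i%C * S t * (J a j * J j b))).
  apply: eq_bigr => j _; rewrite !mxE -/(C s) -/(S s).
  have := JE j cos; have := JE j sin; rewrite -/(C t) -/(S t) => e1 e2.
  set cj := (cos (row_param p t j))%:C%C in e2 *.
  set sj := (sin (row_param p t j))%:C%C in e1 *.
  transitivity (C s * ((a == j)%:R * (cj * (j == b)%:R + 'i%C * sj * J j b)) +
    'i%C * S s * ((J a j * cj) * (j == b)%:R + 'i%C * (J a j * sj) * J j b)).
    by ring.
  by rewrite e1 e2; ring.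
rewrite big_split -!mulr_sumr /= (bigD1 a) //= eqxx mul1r big1 ?addr0;
  last first.
  by move=> j; rewrite eq_sym => /negPf ->; rewrite mul0r.
rewrite big_split -!mulr_sumr /= (bigD1 b) //= eqxx mulr1 big1 ?addr0;
  last first.
  by move=> j /negPf ->; rewrite mulr0.
rewrite -['i%C * S t * \sum_(_ < _) _]mulrA.
have -> : S t * \sum_i J a i * J i b = S t * (a == b)%:R.
  have [ta|ta] := eqVneq (row_param p t a) 0.
    by rewrite /S ta sin0 !mul0r.
  by rewrite -(pair_mx_sqr b qp ta) -EJ mxE.
rewrite -/(C t) -/(S t) row_paramD cosD sinD rmorphB rmorphD !rmorphM /=.
rewrite -/(C t) -/(S t) -/(C s) -/(S s).
transitivity (C s * C t * (a == b)%:R +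
  'i%C * 'i%C * (S s * S t * (a == b)%:R) +
  'i%C * (S s * C t + C s * S t) * J a b); last by ring.
by rewrite -expr2 sqr_i; ring.
Qed.

Lemma expiX0 (R : realType) (p q : nat) : (q <= p)%N ->
  expiX p (0 : 'rV[R]_q) = 1%:M.
Proof.
move=> qp; rewrite expiXE //; apply/matrixP => a b; rewrite !mxE.
have -> : row_param p (0 : 'rV[R]_q) a = 0.
  by rewrite /row_param /ext_ord; case: insub => [k|] //=; rewrite mxE.
by rewrite cos0 sin0 mul1r mulr0 mul0r addr0.
Qed.

Lemma expiX_adjoint (R : realType) (p q : nat) (t : 'rV[R]_q) : (q <= p)%N ->
  (expiX p t) ^t* = expiX p (- t).
Proof.
move=> qp; rewrite !expiXE //; apply/matrixP => a b; rewrite !mxE row_paramN.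
rewrite cosN sinN.
have cr (x : R) : (x%:C%C)^* = x%:C%C by exact: conjc_real.
have ci : ('i%C : R[i])^* = - 'i%C 
    by apply/eqP; rewrite eq_complex /= oppr0 !eqxx.
rewrite rmorphD !rmorphM /= !cr ci !rmorph_nat.
have sym : paired p q b a = paired p q a b 
    by rewrite /paired [(b + a)%N]addnC orbC.
rewrite sym eq_sym; case: (boolP (paired p q a b)) => [ab|_]; last first.
  rewrite !mulr0 !addr0; case: eqP => [->//|_]; by rewrite !mulr0.
rewrite (row_param_paired t ab) !rmorphN; ring.
Qed.

Lemma expiX_unitary (R : realType) (p q : nat) (t : 'rV[R]_q) : (q <= p)%N ->
  expiX p t \is unitarymx.
Proof.
move=> qp; apply/unitarymxP.
by rewrite expiX_adjoint // -expiXD // subrr expiX0.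
Qed.

(** As [exp iX] is a square, it suffices that the square of its determinant is
    [1]: conjugation by a diagonal matrix of signs inverts [exp iX]. *)
Lemma expiX_det (R : realType) (p q : nat) (t : 'rV[R]_q) : (q <= p)%N ->
  \det (expiX p t) = 1.
Proof.
move=> qp; have -> : t = 2^-1 *: t + 2^-1 *: t.
  by rewrite -scalerDl (_ : 2^-1 + 2^-1 = 1) ?scale1r //; field.
rewrite expiXD // det_mulmx; move: (_ *: t) => s.
pose D : 'M[R[i]]_(p + q) := diag_mx (\row_a (if (a < p)%N then 1 else -1)).
have DD : D *m D = 1%:M.
  rewrite mulmx_diag; apply/matrixP => a b; rewrite !mxE.
  by case: ifP => _; rewrite ?mulrNN mulr1.
have DED : D *m expiX p s *m D = expiX p (- s).
  rewrite !expiXE // mul_diag_mx mul_mx_diag.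
  apply/matrixP => a b; rewrite !mxE.
  rewrite row_paramN cosN sinN rmorphN.
  case: eqP => [->|_].
    have -> : paired p q b b = false by rewrite /paired; lia.
    by rewrite !mulr0 !addr0 !mulr1; case: ifP => _; ring.
  rewrite !mulr0 !add0r.
  case: (boolP (paired p q a b)) => [ab|_]; last by rewrite !mulr0 mul0r.
  move: ab; rewrite /paired.
  case: (ltnP a p) => ap; case: (ltnP b p) => bp; try lia; move=> _; ring.
have detE : \det (expiX p s) = \det (expiX p (- s)).
  by rewrite -DED !det_mulmx mulrAC -det_mulmx DD det1 mul1r.
have inv : expiX p s *m expiX p (- s) = 1%:M.
  by apply: etrans (esym (expiXD s (- s) qp)) _; rewrite addrN expiX0.
apply: etrans (congr1 (fun x => \det (expiX p s) * x) detE) _.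
apply: etrans (esym (det_mulmx _ _)) _.
by apply: etrans (congr1 (@determinant _ _) inv) _; rewrite det1.
Qed.

(** * The normalizer of [S(U(p) x U(q))] *)

Lemma SUxUP (R : realType) (p q : nat) (g : 'M[R[i]]_(p + q)) :
  SUxU g <-> SU g /\ forall a b : 'I_(p + q),
    (a < p)%N != (b < p)%N -> g a b = 0.
Proof.
have upper (i : 'I_p) : (lshift q i < p)%N = true by rewrite /= ltn_ord.
have lower (j : 'I_q) : (rshift p j < p)%N = false.
  by rewrite /= ltnNge leq_addr.
split=> [[SUg ur dl]|[SUg g0]].
  split=> // a b; case: (split_ordP a) => i ->; case: (split_ordP b) => j ->;
    rewrite ?upper ?lower //= => _.
    by have /matrixP/(_ i j) := ur; rewrite !mxE.
  by have /matrixP/(_ i j) := dl; rewrite !mxE.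
by split=> //; apply/matrixP => i j; rewrite !mxE g0 // upper lower.
Qed.

Lemma SU_mul (R : realType) (n : nat) (g h : 'M[R[i]]_n) :
  SU g -> SU h -> SU (g *m h).
Proof.
move=> [gU g1] [hU h1]; split; first exact: mul_unitarymx.
by rewrite det_mulmx g1 h1 mulr1.
Qed.

(** [swaps e g]: the matrix [g] preserves ([e = false]) or exchanges
    ([e = true]) the spans of the first [p] and of the last [q] coordinates. *)
Definition swaps (R : realType) (p q : nat) (e : bool) (g : 'M[R[i]]_(p + q)) :=
  forall a b : 'I_(p + q), (a < p)%N (+) (b < p)%N != e -> g a b = 0.

Lemma swaps_mul (R : realType) (p q : nat) (e f : bool)
    (g h : 'M[R[i]]_(p + q)) :
  swaps e g -> swaps f h -> swaps (e (+) f) (g *m h).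
Proof.
move=> sg sh a b ab; rewrite mxE big1 // => c _.
have [ac|ac] := eqVneq ((a < p)%N (+) (c < p)%N) e; last by rewrite sg ?mul0r.
rewrite sh ?mulr0 //; apply: contra ab => /eqP <-; rewrite -ac.
by case: (a < p)%N; case: (b < p)%N; case: (c < p)%N.
Qed.

Lemma normalizer_swaps (R : realType) (p q : nat) (e : bool)
    (g g' : 'M[R[i]]_(p + q)) :
  SU g -> SU g' -> g *m g' = 1%:M -> g' *m g = 1%:M ->
  swaps e g -> swaps e g' -> normalizer (@SU R (p + q)) (@SUxU R p q) g.
Proof.
move=> SUg SUg' gg' g'g sg sg'.
have gu : g \in unitmx by case: (mulmx1_unit gg').
have gV : invmx g = g' by rewrite -[LHS]mulmx1 -gg' mulKmx.
have conjH (u v : 'M[R[i]]_(p + q)) h :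
    SU u -> SU v -> swaps e u -> swaps e v -> SUxU h -> SUxU (u *m h *m v).
  move=> SUu SUv su sv /SUxUP[SUh h0]; apply/SUxUP; split.
    by apply: SU_mul => //; apply: SU_mul.
  have sh : swaps false h.
    by move=> a b ab; apply: h0; move: ab; case: (a < p)%N; case: (b < p)%N.
  have := swaps_mul (swaps_mul su sh) sv; rewrite addbF addbb => s a b ab.
  by apply: s; move: ab; case: (a < p)%N; case: (b < p)%N.
split=> //; rewrite gV; apply/seteqP; split=> [_ [h hH <-]|h hH].
  exact: conjH.
exists (g' *m h *m g); first exact: conjH.
by rewrite !mulmxA gg' mul1mx -mulmxA gg' mulmx1.
Qed.

Lemma SU_expiX (R : realType) (p q : nat) (t : 'rV[R]_q) : (q <= p)%N ->
  SU (expiX p t).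
Proof. by move=> qp; split; [exact: expiX_unitary|exact: expiX_det]. Qed.

Lemma normalizer_expiX (R : realType) (p q : nat) (t : 'rV[R]_q) (e : bool) :
  (q <= p)%N -> swaps e (expiX p t) -> swaps e (expiX p (- t)) ->
  normalizer (@SU R (p + q)) (@SUxU R p q) (expiX p t).
Proof.
move=> qp; apply: normalizer_swaps; try exact: SU_expiX.
  by apply: etrans (esym (expiXD t (- t) qp)) _; rewrite addrN expiX0.
by apply: etrans (esym (expiXD (- t) t qp)) _; rewrite addNr expiX0.
Qed.

Lemma normalizer_sin0 (R : realType) (p q : nat) (t : 'rV[R]_q) : (q <= p)%N ->
  (forall k, sin (t 0 k) = 0) ->
  normalizer (@SU R (p + q)) (@SUxU R p q) (expiX p t).
Proof.
move=> qp s0.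
have key (u : 'rV[R]_q) :
    (forall k, sin (u 0 k) = 0) -> swaps false (expiX p u).
  move=> u0 a b ab; rewrite expiXE // mxE.
  have -> : sin (row_param p u a) = 0.
    rewrite /row_param /ext_ord.
    by case: insub => [k|] /=; [exact: u0|exact: sin0].
  rewrite mulr0 mul0r addr0; case: eqP => [e|_]; rewrite ?mulr0 //.
  by move: ab; rewrite e addbb.
apply: (@normalizer_expiX _ _ _ _ false) => //; apply: key => // k.
by rewrite mxE sinN s0 oppr0.
Qed.

Lemma normalizer_cos0 (R : realType) (q : nat) (t : 'rV[R]_q) :
  (forall k, cos (t 0 k) = 0) ->
  normalizer (@SU R (q + q)) (@SUxU R q q) (expiX q t).
Proof.
move=> c0.
have key (u : 'rV[R]_q) :
    (forall k, cos (u 0 k) = 0) -> swaps true (expiX q u).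
  move=> u0 a b ab; rewrite expiXE // !mxE.
  have -> : cos (row_param q u a) = 0.
    rewrite /row_param /ext_ord; case: insubP => [k _ _ /=|]; first exact: u0.
    by have := ltn_ord a; case: ifP => //; lia.
  have -> : paired q q a b = false.
    apply/negbTE; apply: contra ab => /andP[+ _].
    by case: (ltnP a q) => aq; case: (ltnP b q) => bq //=; lia.
  by rewrite mul0r mulr0 addr0.
apply: (@normalizer_expiX _ _ _ _ true) => //; apply: key => // k.
by rewrite mxE cosN c0.
Qed.

(** * Estimates of spherical functions *)

(** The degrees, sorted increasingly. *)
Definition degrees (q : nat) (m : 'I_q -> nat) (i : nat) : nat :=
  odflt 0%N (ext_ord (fun j : 'I_q => shifted m (rev_ord j)) i).

Lemma degreesE (q : nat) (m : 'I_q -> nat) (j : 'I_q) :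
  degrees m j = shifted m (rev_ord j).
Proof. by rewrite /degrees ext_ordE. Qed.

Lemma degrees_rev (q : nat) (m : 'I_q -> nat) (j : 'I_q) :
  degrees m (rev_ord j) = shifted m j.
Proof. by rewrite degreesE rev_ordK. Qed.

Lemma degrees_lt (q : nat) (m : 'I_q -> nat) (j k : nat) :
  highest_spherical m -> (j < k < q)%N -> (degrees m j < degrees m k)%N.
Proof.
move=> hm /andP[jk kq]; have jq := ltn_trans jk kq.
rewrite -[j]/(nat_of_ord (Ordinal jq)) -[k]/(nat_of_ord (Ordinal kq)).
rewrite !degreesE /shifted.
have := hm (rev_ord (Ordinal kq)) (rev_ord (Ordinal jq)).
by rewrite /= leq_sub2l // => [/(_ isT)|]; lia.
Qed.

(** The Vandermonde product of the eigenvalues. *)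
Definition eig_vdm (R : realType) (a q : nat) (n : nat -> nat) : R :=
  \prod_(j < q) \prod_(k < j) (jac_eig R a (n j) - jac_eig R a (n k)).

Lemma eig_vdm_gt0 (R : realType) (a q : nat) (n : nat -> nat) :
  (forall j k, (j < k < q)%N -> (n j < n k)%N) -> 0 < eig_vdm R a q n.
Proof.
move=> nM; apply: prodr_gt0 => j _; apply: prodr_gt0 => k _.
apply: lt_le_trans (jac_eig_sub _ _ _); first by rewrite ltr0n.
by apply: nM; rewrite !ltn_ord.
Qed.

Lemma norm_det_rev (R : realType) (q : nat) (D : 'I_q -> 'I_q -> R) :
  `|\det (\matrix_(j, k) D (rev_ord j) k)| = `|\det (\matrix_(j, k) D j k)|.
Proof.
have -> : \matrix_(j, k) D (rev_ord j) k =
    row_perm (perm (@rev_ord_inj q)) (\matrix_(j, k) D j k).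
  by apply/matrixP => j k; rewrite !mxE permE.
by rewrite row_permE det_mulmx det_perm normrM normrX normrN1 expr1n mul1r.
Qed.

Lemma prod_rev_pairs (R : realType) (q : nat) (F : 'I_q -> 'I_q -> R) :
  \prod_(j < q) \prod_(k < q | (j < k)%N) F j k =
  \prod_(j < q) \prod_(k < q | (k < j)%N) F (rev_ord j) (rev_ord k).
Proof.
rewrite (reindex_inj rev_ord_inj); apply: eq_bigr => j _.
rewrite (reindex_inj rev_ord_inj); apply: eq_bigl => k /=.
have := ltn_ord j; have := ltn_ord k; lia.
Qed.

(** The value at [t] in terms of the confluent determinant: the constant
    depends on [t] but not on the highest weight. *)
Lemma bk_ext_norm (R : realType) (p q : nat) (t : 'rV[R]_q) :
  exists2 c : R, 0 <= c & forall m : 'I_q -> nat, highest_spherical m ->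
  `|bk_ext p m t| = c *
    `|\det (\matrix_(j < q, k < q) jac_entry (p - q)
         (fun n => ('C(n + (p - q), p - q)%:R)^-1) (cos_nodes t)
         (degrees m j) k)| / eig_vdm R (p - q) q (degrees m).
Proof.
pose P := \prod_(k < q) node_pivot (cos_nodes t) k.
have P0 : P != 0 by apply/prodf_neq0 => k _; exact: node_pivot_neq0.
exists ((BK_const p q)%:R / `|P|); first by rewrite divr_ge0.
move=> m hm; pose s n : R := ('C(n + (p - q), p - q)%:R)^-1; rewrite -/s.
pose D (j k : 'I_q) := jac_entry (p - q) s (cos_nodes t) (shifted m j) k.
have -> : \matrix_(j < q, k < q) jac_entry (p - q) s (cos_nodes t)
      (degrees m j) k = \matrix_(j < q, k < q) D (rev_ord j) k.
  by apply/matrixP => j k; rewrite !mxE degreesE.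
rewrite norm_det_rev.
have -> : \matrix_(j < q, k < q) D j k =
   \matrix_(j < q, k < q) taylor (bk_poly R (p - q) (shifted m j))
     (cos_nodes t k) (node_order (cos_nodes t) k).
  by apply/matrixP => j k; rewrite !mxE /bk_poly taylorZ.
rewrite det_taylor_divdiff -/P normrM /bk_ext /bk_const.
have -> : \prod_(j < q) \prod_(k < q | (j < k)%N)
    (jac_eig R (p - q) (shifted m j) - jac_eig R (p - q) (shifted m k)) =
    eig_vdm R (p - q) q (degrees m).
  rewrite prod_rev_pairs; apply: eq_bigr => j _.
  rewrite (big_ord_widen q (fun k => jac_eig R (p - q) (degrees m j) -
    jac_eig R (p - q) (degrees m k))) ?(ltnW (ltn_ord j)) //.
  by apply: eq_bigr => k _; rewrite !degreesE.
have V0 := eig_vdm_gt0 R (p - q) (fun j k => @degrees_lt q m j k hm).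
rewrite !normrM normfV (gtr0_norm V0) normr_nat.
by field; rewrite normr_eq0 P0 gt_eqF.
Qed.

Lemma det_jac_entry_scale (R : rcfType) (a q : nat) (y : nat -> R)
    (s s' u : nat -> R) (n : nat -> nat) :
  (forall i, s i = u i * s' i) ->
  \det (\matrix_(j < q, k < q) jac_entry a s y (n j) k) =
  \prod_(j < q) u (n j) *
  \det (\matrix_(j < q, k < q) jac_entry a s' y (n j) k).
Proof.
move=> su.
have -> : \matrix_(j < q, k < q) jac_entry a s y (n j) k =
    diag_mx (\row_j u (n j)) *m \matrix_(j < q, k < q) jac_entry a s' y (n j) k.
  apply/matrixP => j k; rewrite mul_diag_mx !mxE /jac_entry su; ring.
rewrite det_mulmx det_diag; congr (_ * _); apply: eq_bigr => j _.
by rewrite mxE.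
Qed.

Lemma prod_degrees (R : realType) (q : nat) (m : 'I_q -> nat) (F : nat -> R) :
  \prod_(j < q) F (degrees m j) = \prod_(j < q) F (shifted m j).
Proof.
rewrite (reindex_inj rev_ord_inj); apply: eq_bigr => j _.
by rewrite degrees_rev.
Qed.

Lemma prod_degrees_lift (R : realType) (q : nat) (m : 'I_q.+1 -> nat)
    (F : nat -> R) :
  \prod_(k < q) F (degrees m k.+1) =
  \prod_(j < q.+1 | (j < q)%N) F (shifted m j).
Proof.
rewrite [RHS](reindex_inj rev_ord_inj) [RHS]big_mkcond [RHS]big_ord_recl /=.
rewrite subn1 ltnn mul1r.
apply: eq_bigr => k _; rewrite ifT; last first.
  by have := ltn_ord k; rewrite /= /bump /=; lia.
by rewrite -degreesE.
Qed.

Lemma bin_ge_succ (a n : nat) : (0 < a)%N -> (n < 'C(n + a, a))%N.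
Proof.
case: a => // a _; elim: n => [|n IH]; first by rewrite binn.
rewrite addSn binS; apply: leq_ltn_trans IH _.
by rewrite -addSnnS -[X in (X < _)%N]addn0 ltn_add2l bin_gt0; lia.
Qed.

Lemma bin_ge_pow (R : realFieldType) (a n : nat) :
  n.+1%:R ^+ a / a`!%:R <= 'C(n + a, a)%:R :> R.
Proof.
rewrite ler_pdivrMr ?ltr0n ?fact_gt0 // -natrX -natrM ler_nat.
rewrite bin_ffact; elim: a => [|a IH]; first by rewrite ffactn0.
rewrite expnS addnS ffactSS leq_mul //; lia.
Qed.

Lemma cos_nodes_le1 (R : realType) (q : nat) (t : 'rV[R]_q) (k : 'I_q) :
  `|cos_nodes t k| <= 1.
Proof. by rewrite cos_nodesE ler_norml cos_geN1 cos_le1. Qed.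

(** The estimate when two nodes differ. *)
Lemma bk_ext_gain (R : realType) (p q : nat) (t : 'rV[R]_q.+1)
    (k0 k1 : 'I_q.+1) :
  cos (2 * t 0 k0) != cos (2 * t 0 k1) ->
  exists2 C : R, 0 <= C & forall m : 'I_q.+1 -> nat, highest_spherical m ->
  `|bk_ext p m t| <= C * \prod_(j < q.+1 | (j < q)%N) (shifted m j).+1%:R^-1.
Proof.
move=> kk; have [c c0 hc] := bk_ext_norm p t; move: hc.
set s := fun n => _ => hc.
have C1 n : 1 <= 'C(n + (p - q.+1), p - q.+1)%:R :> R.
  by rewrite ler1n bin_gt0 leq_addl.
have s1 n : `|s n| <= 1.
  rewrite /s normfV normr_nat invf_le1 ?C1 //.
  exact: lt_le_trans ltr01 (C1 n).
have [] := @jac_grouped R (p - q.+1) q.+1 (cos_nodes t) s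
  (@cos_nodes_le1 _ _ t).
- move=> k _ n; rewrite /s mulVf ?normr1 //.
  by rewrite gt_eqF // (lt_le_trans ltr01 (C1 n)).
- by move=> k _ n; exact: s1.
- move=> k _ n; apply: le_trans (s1 n) _.
  by rewrite -[leLHS]sqrtr1 ler_wsqrtr // ler1n.
move=> K hK; exists (c * `|group_const q.+1 K|); first exact: mulr_ge0.
move=> m hm; rewrite hc //.
have nM j k := @degrees_lt q.+1 m j k hm.
have V0 := eig_vdm_gt0 R (p - q.+1) nM.
have [P gP] := hK _ nM.
have kk' : cos_nodes t k0 != cos_nodes t k1 by rewrite !cos_nodesE.
have := det_grouped_gain gP kk'.
set d := `|\det _|; rewrite -/(eig_vdm R (p - q.+1) q.+1 (degrees m)).
set V := eig_vdm _ _ _ _ in V0 *.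
rewrite (prod_degrees_lift m (fun n => n.+1%:R)) prodfV.
set W := \prod_(_ < _ | _) _ => dW.
have W0 : 0 < W by apply: prodr_gt0 => j _; rewrite ltr0n.
rewrite -!mulrA ler_wpM2l // ler_pdivrMr // mulrAC ler_pdivlMr //.
apply: le_trans dW _; rewrite (ler_wpM2r (ltW V0)) //; exact: ler_norm.
Qed.

(** If the normalizing factors are split as [u n * s n], where the scaling by
    [s] keeps the polynomials bounded at the nodes in the required sense, then
    the factors [u n] are gained. *)
Lemma bk_ext_scaled (R : realType) (p q : nat) (t : 'rV[R]_q)
    (s u : nat -> R) :
  (forall n, ('C(n + (p - q), p - q)%:R)^-1 = u n * s n) ->
  (forall n, 0 <= u n) ->
  (forall k, cos (2 * t 0 k) = 1 -> forall n,
     `|s n * 'C(n + (p - q), p - q)%:R| <= 1) ->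
  (forall k, cos (2 * t 0 k) = -1 -> forall n, `|s n| <= 1) ->
  (forall k, `|cos (2 * t 0 k)| < 1 -> forall n, `|s n| <= Num.sqrt n.+1%:R) ->
  exists2 C : R, 0 <= C & forall m : 'I_q -> nat, highest_spherical m ->
  `|bk_ext p m t| <= C * \prod_(j < q) u (shifted m j).
Proof.
move=> su u0 h1 hN1 hi; have [c c0 hc] := bk_ext_norm p t; move: hc.
have [] := @jac_grouped R (p - q) q (cos_nodes t) s (@cos_nodes_le1 _ _ t).
- by move=> k; rewrite cos_nodesE; exact: h1.
- by move=> k; rewrite cos_nodesE; exact: hN1.
- by move=> k; rewrite cos_nodesE; exact: hi.
move=> K hK hc; exists (c * `|group_const q K|); first exact: mulr_ge0.
move=> m hm; rewrite hc //.
have nM j k := @degrees_lt q m j k hm.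
have V0 := eig_vdm_gt0 R (p - q) nM.
have [P gP] := hK _ nM; have := det_grouped_bound gP.
rewrite -/(eig_vdm R (p - q) q (degrees m)) => dV.
rewrite (@det_jac_entry_scale _ _ _ (cos_nodes t) _ _ _ (degrees m) su) normrM.
rewrite (prod_degrees m) ger0_norm ?prodr_ge0 //.
set U := \prod_(_ < _) _; rewrite -!mulrA ler_wpM2l // [leRHS]mulrC.
rewrite ler_wpM2l ?prodr_ge0 // ler_pdivrMr //.
apply: le_trans dV _; rewrite (ler_wpM2r (ltW V0)) //; exact: ler_norm.
Qed.

Lemma sin_cos2_eq1 (R : realType) (x : R) : cos (2 * x) = 1 -> sin x = 0.
Proof.
move=> h; have := cos2_sub x 0; rewrite mulr0 cos0 h subrr addr0 subr0.
move/eqP; rewrite eq_sym mulf_eq0 oppr_eq0 pnatr_eq0 /= -expr2 expf_eq0 /=.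
by move/eqP.
Qed.

Lemma cos_cos2_eqN1 (R : realType) (x : R) : cos (2 * x) = -1 -> cos x = 0.
Proof.
move=> h; have := cos2_sub x 0; rewrite mulr0 cos0 h addr0 subr0 -expr2.
rewrite sin2cos2 => e; apply/eqP; rewrite -sqrf_eq0; apply/eqP; lra.
Qed.

(** The factor contributed by a degree [n] to the estimate outside the
    normalizer. *)
Definition decay (R : realType) (p q n : nat) : R :=
  if (q < p)%N then n.+1%:R^-1 else (Num.sqrt n.+1%:R)^-1.

Lemma decay_le1 (R : realType) (p q n : nat) : 0 <= decay R p q n <= 1.
Proof.
have s0 : 1 <= Num.sqrt n.+1%:R :> R.
  by rewrite -[leLHS]sqrtr1 ler_wsqrtr // ler1n.
rewrite /decay; case: ifP => _.
  by rewrite invr_ge0 ler0n /= invf_le1 ?ler1n ?ltr0n.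
by rewrite invr_ge0 sqrtr_ge0 invf_le1 // (lt_le_trans ltr01).
Qed.

Lemma inv_le_decay (R : realType) (p q n : nat) : n.+1%:R^-1 <= decay R p q n.
Proof.
rewrite /decay; case: ifP => // _.
have s0 : 1 <= Num.sqrt n.+1%:R :> R.
  by rewrite -[leLHS]sqrtr1 ler_wsqrtr // ler1n.
rewrite lef_pV2 ?posrE ?ltr0n ?(lt_le_trans ltr01) //.
rewrite -[leRHS]sqr_sqrtr // expr2 ler_peMr // (le_trans ler01) //.
Qed.

Lemma bk_ext_decay (R : realType) (p q : nat) (t : 'rV[R]_q.+1) :
  (q.+1 <= p)%N ->
  ~ normalizer (@SU R (p + q.+1)) (@SUxU R p q.+1) (expiX p t) ->
  exists2 C : R, 0 <= C & forall m : 'I_q.+1 -> nat, highest_spherical m ->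
  `|bk_ext p m t| <=
    C * \prod_(j < q.+1 | (j < q)%N) decay R p q.+1 (shifted m j).
Proof.
move=> qp nN.
have [/existsP[k k_ne]|/existsPn k_eq] :=
    boolP [exists k, cos (2 * t 0 k) != cos (2 * t 0 ord0)].
  have [C C0 hC] := bk_ext_gain p k_ne; exists C => // m hm.
  apply: le_trans (hC m hm) _; apply: ler_wpM2l => //; apply: ler_prod => j _.
  by rewrite invr_ge0 ler0n inv_le_decay.
have {}k_eq k : cos (2 * t 0 k) = cos (2 * t 0 ord0).
  by apply/eqP; have := k_eq k; rewrite negbK.
set y := cos (2 * t 0 ord0) in k_eq.
have y1 : y != 1.
  apply/eqP => y1; apply: nN; apply: normalizer_sin0 => // k.
  by apply: sin_cos2_eq1; rewrite k_eq.
have yN1 : y = -1 -> (q.+1 < p)%N.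
  move=> yN1; rewrite ltn_neqAle qp andbT; apply/eqP => pq; subst p.
  by apply: nN; apply: normalizer_cos0 => k; apply: cos_cos2_eqN1; rewrite k_eq.
set a := (p - q.+1)%N.
have C0 n : 0 < 'C(n + a, a)%:R :> R by rewrite ltr0n bin_gt0 leq_addl.
have sq0 n : 0 < Num.sqrt n.+1%:R :> R by rewrite sqrtr_gt0 ltr0n.
have sq1 n : 1 <= Num.sqrt n.+1%:R :> R.
  by rewrite -[leLHS]sqrtr1 ler_wsqrtr // ler1n.
(* Interior polynomials can afford the factor [sqrt (n + 1)]. *)
pose s n : R := if y == -1 then 1 else Num.sqrt n.+1%:R.
have s0 n : 0 < s n by rewrite /s; case: ifP.
pose u n : R := ('C(n + a, a)%:R)^-1 / s n.
have u0 n : 0 <= u n by rewrite divr_ge0 ?invr_ge0 // ltW.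
have ud n : u n <= decay R p q.+1 n.
  rewrite /decay; case: ifP => pq.
    have a0 : (0 < a)%N by rewrite subn_gt0.
    rewrite /u -[leRHS]mulr1 ler_pM ?invr_ge0 ?(ltW (s0 n)) //.
      by rewrite lef_pV2 ?posrE ?C0 ?ltr0n // ler_nat bin_ge_succ.
    by rewrite invf_le1 // /s; case: ifP.
  rewrite /u /s; case: eqP => [/yN1|_]; first by rewrite pq.
  rewrite ler_piMl ?invr_ge0 ?(ltW (sq0 n)) // invf_le1 // ler1n.
  by rewrite bin_gt0 leq_addl.
have [||||C C1 hC] := @bk_ext_scaled R p q.+1 t s u _ u0.
- by move=> n; rewrite /u divfK // gt_eqF.
- by move=> k; rewrite k_eq => /eqP; rewrite (negPf y1).
- by move=> k; rewrite k_eq => yE n; rewrite /s yE eqxx normr1.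
- by move=> k _ n; rewrite ger0_norm ?(ltW (s0 n)) // /s; case: ifP.
exists C => // m hm; apply: le_trans (hC m hm) _; apply: ler_wpM2l => //.
rewrite [leRHS]big_mkcond; apply: ler_prod => j _; rewrite u0 /=.
apply: le_trans (ud _) _; case: ifP => // _.
by have /andP[] := decay_le1 R p q.+1 (shifted m j).
Qed.

Lemma sin_eq0_pi (R : realType) (x : R) : sin x = 0 -> eqmod_pi x 0.
Proof.
have pos (y : R) : 0 <= y -> sin y = 0 -> exists n : nat, y = n%:R * pi.
  move=> y0 sy; have ypi : 0 <= y / pi by rewrite divr_ge0 // pi_ge0.
  have := truncn_itv ypi; set n := Num.Def.trunc _ => /andP[n1 n2].
  exists n; rewrite ler_pdivlMr ?pi_gt0 // in n1.
  rewrite ltr_pdivrMr ?pi_gt0 // -natr1 mulrDl mul1r in n2.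
  have := alternatingn (@sinDpi R) n (y - n%:R * pi).
  rewrite -[pi *+ n]mulr_natl subrK sy => /esym/eqP.
  rewrite mulf_eq0 signr_eq0 /=.
  move=> /eqP s0; apply/eqP; rewrite eq_le n1 andbT leNgt; apply/negP => ny.
  have : 0 < sin (y - n%:R * pi).
    by apply: sin_gt0_pi; rewrite subr_gt0 ny /= ltrBlDl.
  by rewrite s0 ltxx.
move=> sx; have [x0|x0] := leP 0 x.
  by have [n ->] := pos x x0 sx; exists n%:Z; rewrite subr0.
have [||n xE] := pos (- x); first by rewrite oppr_ge0 ltW.
  by rewrite sinN sx oppr0.
by exists (- n%:Z); rewrite subr0 mulrNz mulNr -[LHS]opprK xE.
Qed.

Lemma regular_distinct_cos (R : realType) (q : nat) (t : 'rV[R]_q) :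
  regular t -> distinct_cos t.
Proof.
move=> [h _] j k jk; have [hm hp] := h j k jk.
rewrite -subr_eq0 cos2_sub; apply/eqP => /eqP.
rewrite mulf_eq0 oppr_eq0 pnatr_eq0 /= mulf_eq0 => /orP[] /eqP /sin_eq0_pi [z].
  by rewrite subr0 => e; apply: hp; exists z; rewrite opprK.
by rewrite subr0 => e; apply: hm; exists z.
Qed.

Lemma regular_cos_lt1 (R : realType) (q : nat) (t : 'rV[R]_q) (k : 'I_q) :
  regular t -> `|cos (2 * t 0 k)| < 1.
Proof.
move=> [_ /(_ k)[h0 hpi]]; rewrite lt_neqAle ler_norml cos_geN1 cos_le1 !andbT.
apply/negP; rewrite eqr_norml ler01 andbT => /orP[] /eqP.
  by move=> /sin_cos2_eq1 /sin_eq0_pi.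
move=> /cos_cos2_eqN1 c0; apply: hpi.
have [z zE] : eqmod_pi (t 0 k - pi / 2) 0.
  by apply: sin_eq0_pi; rewrite sinBpihalf c0 oppr0.
by exists z; rewrite -zE subr0.
Qed.

Lemma bk_ext_regular (R : realType) (p q : nat) (t : 'rV[R]_q) :
  (q <= p)%N -> regular t ->
  exists2 C : R, 0 <= C & forall m : 'I_q -> nat, highest_spherical m ->
  `|bk_ext p m t| <= C * \prod_(j < q)
      ((shifted m j).+1%:R `^ (- p%:R + j.+1%:R - 2^-1)).
Proof.
move=> qp rt; have dt := regular_distinct_cos rt.
have [c c0 hc] := bk_ext_norm p t; move: hc; set a := (p - q)%N => hc.
have : forall k : 'I_q, exists C, 0 <= C /\ forall n,
    `|taylor (jacp R a 0 n) (cos_nodes t k) (node_order (cos_nodes t) k)| <=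
    C / Num.sqrt n.+1%:R.
  move=> k; have yk : `|cos_nodes t k| < 1.
    by rewrite cos_nodesE; exact: regular_cos_lt1.
  have [C [C0 hC]] := taylor_jacp_bound a 0 (node_order (cos_nodes t) k) yk.
  exists C; split=> // n; have := hC n.
  by rewrite (distinct_node_order k dt) expr0 mul1r.
move=> /fin_all_exists[u hu]; pose K := \sum_k u k.
have uK k : u k <= K.
  by rewrite /K (bigD1 k) //= lerDl sumr_ge0 // => i _; have [] := hu i.
have K0 : 0 <= K by apply: sumr_ge0 => i _; have [] := hu i.
pose L := a`!%:R * K.
have L0 : 0 <= L by rewrite mulr_ge0.
exists (c * (q`!%:R * L ^+ q)); first by rewrite !mulr_ge0 // exprn_ge0.
move=> m hm; rewrite hc // -!mulrA ler_wpM2l //.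
have nM j k := @degrees_lt q m j k hm.
have V0 := eig_vdm_gt0 R a nM.
pose b j : R := (degrees m j).+1%:R.
have b0 j : 0 < b j by rewrite ltr0n.
have sb0 j : 0 < Num.sqrt (b j) by rewrite sqrtr_gt0.
have detL := @det_le_prod R q (\matrix_(j < q, k < q) jac_entry a
  (fun n => ('C(n + a, a)%:R)^-1) (cos_nodes t) (degrees m j) k)
  (\prod_(j < q) (L * (b j ^+ a * Num.sqrt (b j))^-1)).
have VE : \prod_(j < q) b j ^+ j <= eig_vdm R a q (degrees m).
  apply: ler_prod => j _; rewrite exprn_ge0 ?(ltW (b0 _)) //=.
  have -> : b j ^+ j = \prod_(k < j) b j by rewrite prodr_const card_ord.
  apply: ler_prod => k _; rewrite (ltW (b0 _)) /=.
  by apply: jac_eig_sub; apply: nM; rewrite !ltn_ord.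
have W0 : 0 < \prod_(j < q) b j ^+ j.
  by apply: prodr_gt0 => j _; rewrite exprn_gt0.
apply: (@le_trans _ _ ((q`!%:R *
    \prod_(j < q) (L * (b j ^+ a * Num.sqrt (b j))^-1)) /
    \prod_(j < q) b j ^+ j)).
  apply: ler_pM; rewrite ?invr_ge0 ?(ltW V0) //.
    apply: detL => s; apply: ler_prod => j _.
    rewrite normr_ge0 mxE /= /jac_entry.
    have [u0 /(_ (degrees m j)) hj] := hu (s j).
    rewrite normrM normfV normr_nat.
    have Ka : ('C(degrees m j + a, a)%:R)^-1 <= a`!%:R / b j ^+ a :> R.
      rewrite -[leRHS]invrK invf_div lef_pV2 ?bin_ge_pow // posrE.
        by rewrite ltr0n bin_gt0 leq_addl.
      by rewrite divr_gt0 ?exprn_gt0 // ltr0n fact_gt0.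
    apply: le_trans (ler_pM _ _ Ka hj) _; rewrite ?invr_ge0 //.
    rewrite /L invfM [leLHS]mulrACA ler_wpM2r ?ler_wpM2l //.
    by rewrite mulr_ge0 ?invr_ge0 ?sqrtr_ge0 // exprn_ge0 // ltW.
  by rewrite lef_pV2 ?posrE.
rewrite big_split prodr_const card_ord -!mulrA !ler_wpM2l ?exprn_ge0 //.
rewrite -prodfV -big_split /= le_eqVlt; apply/orP; left; apply/eqP.
rewrite [LHS](reindex_inj rev_ord_inj); apply: eq_bigr => j _.
rewrite /b degrees_rev; set x : R := _.+1%:R.
have x0 : 0 <= x by rewrite ler0n.
have xn0 : x != 0 by rewrite pnatr_eq0.
have -> : - p%:R + j.+1%:R - 2^-1 =
    - (((p - q) + rev_ord j)%:R + 2^-1) :> R.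
  have jq := ltn_ord j.
  have -> : p%:R = ((p - q) + rev_ord j)%:R + j.+1%:R :> R.
    by rewrite -natrD; congr _%:R; rewrite /=; lia.
  by ring.
rewrite powRN powRD; last by rewrite xn0 implybT.
rewrite powR_mulrn // powR12_sqrt // exprD -invfM -/a; congr (_^-1).
by ring.
Qed.

Theorem theorem1 (R : realType) (p q : nat) (hq : (2 <= q)%N) (hpq : (q <= p)%N) :
  (forall t : 'rV[R]_q,
     ~ normalizer (@SU R (p + q)) (@SUxU R p q) (expiX p t) ->
     exists C : R, forall (m : 'I_q -> nat) (phi : 'M[R[i]]_(p + q) -> R[i]),
       highest_spherical m ->
       spherical_function (sph_weight R m) phi ->
       Berezin_Karpelevich m phi ->
       ((q < p)%N ->
          `|phi (expiX p t)| <=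
            (C * \prod_(j < q | (j < q.-1)%N) ((shifted m j)%:R + 1)^-1)%:C%C) /\
       (p = q ->
          `|phi (expiX p t)| <=
            (C * \prod_(j < q | (j < q.-1)%N)
                   ((shifted m j)%:R + 1) `^ (- 2^-1))%:C%C)) /\
  (forall t : 'rV[R]_q,
     regular t ->
     exists C : R, forall (m : 'I_q -> nat) (phi : 'M[R[i]]_(p + q) -> R[i]),
       highest_spherical m ->
       spherical_function (sph_weight R m) phi ->
       Berezin_Karpelevich m phi ->
       `|phi (expiX p t)| <=
         (C * \prod_(j < q)
                ((shifted m j)%:R + 1) `^ (- p%:R + j.+1%:R - 2^-1))%:C%C).
Proof.
case: q hq hpq => [//|q] hq hpq; split=> t.
  move=> /(bk_ext_decay hpq)[C C0 hC]; exists C => m phi hm _ bk.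
  have le := hC m hm; rewrite (Berezin_Karpelevich_ext t bk) normc_real !lecR.
  split=> pq.
    apply: le_trans le _; rewrite ler_wpM2l // ler_prod // => j _.
    have /andP[-> _] := decay_le1 R p q.+1 (shifted m j).
    by rewrite /decay pq natr1 /=.
  apply: le_trans le _; rewrite ler_wpM2l // ler_prod // => j _.
  have /andP[-> _] := decay_le1 R p q.+1 (shifted m j).
  by rewrite /decay pq ltnn natr1 powRN powR12_sqrt /=.
move=> /(bk_ext_regular hpq)[C C0 hC]; exists C => m phi hm _ bk.
rewrite (Berezin_Karpelevich_ext t bk) normc_real lecR.
apply: le_trans (hC m hm) _; rewrite ler_wpM2l //.
by under eq_bigr do rewrite -natr1.
Qed.
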